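(* For any $\delta\in(0,1/8)$ and $\varepsilon\in(0,1/2)$ there exists $n_0=n_0(\delta,\varepsilon)$ such that for transitive permutation groups $G$ on a set $\Omega$ with $|\Omega|=n>n_0$ the following hold. Consider either the natural action of $G$ on the set $S=\Omega_m$ of $m$-element subsets of $\Omega$ with $m\in(n\varepsilon,\,n(1-\varepsilon))$, in which case put $\xi=\frac{\sqrt{m^2+(n-m)^2}}{n}$, or the natural action of $G$ on the set $S=\Omega_{(m)}$ of multisets of weight $m$ on $\Omega$ with $m\in(n\varepsilon/(1-\varepsilon),\,n(1-\varepsilon)/\varepsilon)$, in which case put $\xi=\left(\frac{n}{n+2m}\right)^{1/2}$. (a) If $G$ is uniprimitive, then in each of these actions there exists at least one orbit $\mathcal O$ of size $$|\mathcal O|\ge|G|^{A/(\ln\ln|G|)^2},\qquad A=\left(\frac18-\delta\right)|\ln\xi|.$$ (b) If $G$ is $2$-transitive and different from $\mathrm{Sym}(\Omega)$ and $\mathrm{Alt}(\Omega)$, then in each of these actions the proportion of regular orbits among all orbits is $1-o(1)$ as $n\to\infty$. More precisely, the average stabilizer size $\langle\mathrm{Stab}\rangle$ satisfies in both cases $$\langle\mathrm{Stab}\rangle-1\le\xi^{\,n/3-(2/3+\delta)\sqrt n}.$$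
   Context: A permutation group on $\Omega$ is primitive if it is transitive and preserves no nontrivial partition of $\Omega$ into blocks; it is $2$-transitive if it is transitive on ordered pairs of distinct points; it is uniprimitive if it is primitive but not $2$-transitive. A multiset of weight $m$ on $\Omega$ is a function $\varkappa:\Omega\to\mathbb{Z}_{\ge0}$ with $\sum_{\omega}\varkappa(\omega)=m$. An orbit of $G$ is regular if its size is $|G|$. The average stabilizer size of the action of $G$ on $S$ is $\langle\mathrm{Stab}\rangle=\frac1{|S|}\sum_{s\in S}|\mathrm{Stab}_G(s)|$. The $o(1)$ in (b) is for fixed $\varepsilon$, uniformly in $G$ and $m$ in the stated ranges. *)

(* Defs.v *)
From HB Require Import structures.
From mathcomp Require Import all_boot all_order all_algebra.
From mathcomp Require Import all_fingroup all_solvable.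
From mathcomp Require Import all_classical all_reals all_analysis.

Set Implicit Arguments.
Unset Strict Implicit.
Unset Printing Implicit Defensive.

Import Order.TTheory GRing.Theory Num.Theory.
Import numFieldNormedType.Exports.
Import GroupScope.

Local Open Scope ring_scope.

Definition two_transitive (T : finType) (G : {group {perm T}}) : bool :=
  [transitive^2 G, on [set: T]%SET | 'P].

Definition uniprimitive (T : finType) (G : {group {perm T}}) : bool :=
  [primitive G, on [set: T]%SET | 'P] && ~~ two_transitive G.

Definition msubsets (T : finType) (m : nat) : {set {set T}} :=
  finset (fun A : {set T} => #|A| == m).

(* A multiset of weight m only takes values at most m, so the multisets of
   weight m are exactly the functions T -> {0, ..., m} with sum m.  Bounding
   the values makes the ambient type finite. *)
Definition multisets (T : finType) (m : nat) :
    {set {ffun T -> 'I_m.+1}} :=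
  finset (fun k : {ffun T -> 'I_m.+1} => (\sum_(x : T) k x)%N == m).

(* The inverse is needed for a right action; it moves the multiplicity of x
   to g x, which is the convention of 'P^* on subsets. *)
Definition multiset_act (T : finType) (m : nat) (k : {ffun T -> 'I_m.+1})
    (g : {perm T}) : {ffun T -> 'I_m.+1} :=
  [ffun x => k ((g^-1)%g x)].

Lemma multiset_act1 (T : finType) (m : nat) (k : {ffun T -> 'I_m.+1}) :
  multiset_act k 1%g = k.
Proof. by apply/ffunP => x; rewrite ffunE invg1 perm1. Qed.

Lemma multiset_actM (T : finType) (m : nat) (k : {ffun T -> 'I_m.+1}) :
  act_morph (@multiset_act T m) k.
Proof. by move=> g h; apply/ffunP => x; rewrite !ffunE invMg permM. Qed.

Definition multiset_action (T : finType) (m : nat) :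
    {action {perm T} &-> {ffun T -> 'I_m.+1}} :=
  TotalAction (@multiset_act1 T m) (@multiset_actM T m).

Section Orbits.
Variables (gT : finGroupType) (sT : finType) (to : {action gT &-> sT}).

Definition orbits (G : {group gT}) (S : {set sT}) : {set {set sT}} :=
  imset (orbit to G) (mem S).

Definition regular_ratio (R : realType) (G : {group gT}) (S : {set sT}) : R :=
  #|finset (fun O : {set sT} => (O \in orbits G S) && (#|O| == #|G|))|%:R
  / #|orbits G S|%:R.

Definition avg_stab (R : realType) (G : {group gT}) (S : {set sT}) : R :=
  #|S|%:R^-1 * \sum_(s in S) #|('C_G[s | to])%g|%:R.

End Orbits.

Definition xi_subsets (R : realType) (n m : nat) : R :=
  Num.sqrt (m%:R ^+ 2 + (n%:R - m%:R) ^+ 2) / n%:R.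

Definition xi_multisets (R : realType) (n m : nat) : R :=
  Num.sqrt (n%:R / (n%:R + 2 * m%:R)).

Definition has_large_orbit (R : realType) (gT : finGroupType) (sT : finType)
    (to : {action gT &-> sT}) (G : {group gT}) (S : {set sT})
    (delta xi : R) : Prop :=
  let A := (1 / 8 - delta) * `|ln xi| in
  exists2 O : {set sT}, O \in orbits to G S &
    (#|O|%:R : R) >= #|G|%:R `^ (A / (ln (ln #|G|%:R)) ^+ 2).

(* n is the degree of G, and u n stands for the o(1) term in the lower bound
   1 - o(1) for the proportion of regular orbits. *)
Definition mostly_regular (R : realType) (gT : finGroupType) (sT : finType)
    (to : {action gT &-> sT}) (G : {group gT}) (S : {set sT})
    (n : nat) (u : nat -> R) (delta xi : R) : Prop :=
  1 - u n <= regular_ratio to R G S /\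
  avg_stab to R G S - 1 <=
    xi `^ (n%:R / 3 - (2 / 3 + delta) * Num.sqrt n%:R).

(* Main.v *)
(** The average stabilizer size is 1 plus the sum, over the nontrivial elements g of G, of the
    proportion of S fixed by g.  A generating function, which factors over the cycles of g, bounds
    this proportion by a polynomial in n times xi^|supp g|, so both parts follow from a lower bound
    on the minimal degree of G and an upper bound on its order.

    If G is uniprimitive, any two points are distinguished by at least sqrt n / 2 points, that is,
    they form pairs in different orbitals with these points (Babai).  This bounds the minimal degree
    and, by adding random base points, shows that ln |G| is at most (1 + o(1)) sqrt n (ln n)^2.

    If G is doubly transitive, the variance of the intersection of the supports of two conjugate
    elements of minimal degree, whose commutator moves few points if the intersection is small,
    gives the minimal degree n / 3 - (2 / 3) sqrt n (Bochert).  As to the order,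
      either the pointwise
    stabilizer of few points has no orbit containing almost all points, and then a few conjugates of
    this set of points form a base; or G induces the full symmetric group on a set of about n^(1/5)
    points.  In the latter case take an element with cycles of many coprime prime power lengths on
    this set.  Its powers move at least n / 4 points, so that some point lies in a cycle of length
    divisible by many of these numbers, hence greater than n. *)

Require Import Defs.
From HB Require Import structures.
From mathcomp Require Import all_boot all_order all_algebra.
From mathcomp Require Import all_fingroup all_solvable.
From mathcomp Require Import zify ring lra.
From mathcomp Require Import reals.

Set Implicit Arguments.
Unset Strict Implicit.
Unset Printing Implicit Defensive.

Import GroupScope.

(** * Three-cycles *)

Section ThreeCycles.
Variable T : finType.
Implicit Types (g h x : {perm T}) (G : {group {perm T}}) (a b c d : T).

(** [xi] enters the asymptotics only through eps / 2 <= xi^2 <= 1 - eps. This makes the thresholds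
    uniform in m and lets both actions share one argument. In (a), an orbit of size at least |G| /
    <Stab> has, up to polynomial factors, at least the smaller of |G| and xi^(- sqrt n / 2) points.
    Unless |G| is small, ln ln |G| >= (ln n) / 2, so the order bound, whose leading constant matters
    here, makes the claimed exponent at most about (1/8 - delta) 4 |ln xi| sqrt n. Thus 1/8 is the
    1/2 of the minimal degree times the 1/4 of (ln ln |G|)^2. In (b), |G| has to be absorbed by
    xi^(- delta sqrt n), so ln |G| = o(sqrt n) is required. A base made of conjugates of an l-set
    gives ln |G| of order l^2 (ln n)^2, so l must stay below n^(1/4), while a product of ten prime
    powers of order l must exceed n, so l must be above n^(1/10). The choice n^(1/5) lies in
    between. The o(1) obtained is 1 / (n + 1). *)

Definition supp g : {set T} := [set a | g a != a].

Definition c3 a b c : {perm T} := tperm a b * tperm a c.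

Lemma c3J a b c x : c3 a b c ^ x = c3 (x a) (x b) (x c).
Proof. by rewrite conjMg !tpermJ. Qed.

Lemma c3V a b c : (c3 a b c)^-1 = c3 a c b.
Proof. by rewrite invMg !tpermV. Qed.

Lemma c3_rot a b c : uniq [:: a; b; c] -> c3 a b c = c3 b c a.
Proof.
rewrite /= !inE negb_or !andbT => /andP[/andP[ab ac] bc].
have [ba ca cb] : [/\ b != a, c != a & c != b] by split; rewrite eq_sym.
apply/permP => y; rewrite !permM.
have [->|ya] := eqVneq y a.
  by rewrite tpermL (@tpermD _ a c b) // (@tpermD _ b c a) // tpermR.
have [->|yb] := eqVneq y b.
  by rewrite tpermR !tpermL tpermD.
have [->|yc] := eqVneq y c.
  by rewrite tpermR (@tpermD _ a b c) // tpermR tpermL.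
by rewrite !tpermD // eq_sym.
Qed.

Lemma c3E a b c : uniq [:: a; b; c] ->
  [/\ c3 a b c a = b, c3 a b c b = c, c3 a b c c = a &
    forall y, y \notin [:: a; b; c] -> c3 a b c y = y].
Proof.
rewrite /= !inE negb_or !andbT => /andP[/andP[ab ac] bc]; split.
- by rewrite permM tpermL tpermD // eq_sym.
- by rewrite permM tpermR tpermL.
- by rewrite permM (tpermD ac) // tpermR.
- by move=> y; rewrite !inE !negb_or => /and3P[ya yb yc]; rewrite permM !tpermD 1?eq_sym.
Qed.

Lemma uniq3 a b c : a != b -> a != c -> b != c -> uniq [:: a; b; c].
Proof. by move=> ab ac bc; rewrite /= !inE negb_or ab ac bc. Qed.

(** Conjugating (a b c) by (a b d) and by its inverse fixes c and replaces the pair (a, b) by (b, d)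
    and (d, a). *)
Lemma c3_step G a b c d : uniq [:: a; b; c; d] ->
  c3 a b c \in G -> c3 a b d \in G -> (c3 b d c \in G) /\ (c3 d a c \in G).
Proof.
rewrite /= !inE !negb_or !andbT => /and3P[/and3P[ab ac ad] /andP[bc bd] cd] Gc Gd.
have [|ea eb ed eo] := @c3E a b d; first exact: uniq3.
have [|fa fd fb fo] := @c3E a d b; first by rewrite uniq3 // eq_sym.
have cn : c \notin [:: a; b; d] by rewrite !inE !negb_or [c == a]eq_sym [c == b]eq_sym ac bc.
have cn' : c \notin [:: a; d; b] by rewrite !inE !negb_or [c == a]eq_sym [c == b]eq_sym ac bc cd.
split; first by have := groupJ Gc Gd; rewrite c3J ea eb (eo c cn).
have Gd' : c3 a d b \in G by rewrite -c3V groupV.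
by have := groupJ Gc Gd'; rewrite c3J fa fb (fo c cn').
Qed.

(** Take (a b c) and (a d e) in G. Generically, conjugating the second by the first gives (b d e),
    and [c3_step] for (d e a) and (d e b) yields (b d a). Coincidences among b, c, d, e are treated
    separately. *)
Lemma all_c3 G : (forall a b, a != b -> exists c, uniq [:: a; b; c] /\ c3 a b c \in G) ->
  forall a b d, uniq [:: a; b; d] -> c3 a b d \in G.
Proof.
move=> H a b d; rewrite /= !inE negb_or !andbT => /andP[/andP[ab ad] bd].
have [c []] := H a b ab; rewrite /= !inE negb_or !andbT => /andP[/andP[_ ac] bc] Gc.
have [e []] := H a d ad; rewrite /= !inE negb_or !andbT => /andP[/andP[_ ae] de] Ge.
have [<-//|cd] := eqVneq c d.
have [eb|eb] := eqVneq e b; first by rewrite -c3V groupV -{1}eb.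
have [ce|ce] := eqVneq c e.
  rewrite -{}ce in Ge ae de eb *.
  have G1 : c3 c a b \in G by rewrite c3_rot // uniq3 // eq_sym.
  have G2 : c3 c a d \in G by rewrite c3_rot // uniq3 // eq_sym.
  have [|G3 _] := c3_step _ G1 G2; last by rewrite -c3V groupV.
  by rewrite /= !inE !negb_or !andbT ab ad bd cd [c == a]eq_sym [c == b]eq_sym ac bc.
have [|ea eb' ec eo] := @c3E a b c; first exact: uniq3.
have := groupJ Ge Gc; rewrite c3J ea !eo; last 2 first.
- by rewrite !inE !negb_or [e == a]eq_sym [e == c]eq_sym ae eb ce.
- by rewrite !inE !negb_or ![d == _]eq_sym ad bd cd.
move=> Gb.
have G1 : c3 d e a \in G by rewrite -c3_rot // uniq3.
have G2 : c3 d e b \in G by rewrite -c3_rot // uniq3 // eq_sym.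
have [|_ G3] := c3_step _ G1 G2.
  by rewrite /= !inE !negb_or !andbT de ![d == _]eq_sym ad bd [e == a]eq_sym ae ab eb.
by rewrite c3_rot ?uniq3.
Qed.

Lemma c3_Alt a b c : uniq [:: a; b; c] -> c3 a b c \in 'Alt_T.
Proof.
rewrite Alt_even odd_permM !odd_tperm /= !inE negb_or !andbT.
by case/andP => /andP[-> ->].
Qed.

(** The conjugates of one 3-cycle under the symmetric group generate a nontrivial normal subgroup
    [N] of Alt. Simplicity, which needs five points, gives N = Alt, and all generators of [N] lie in
    G. *)
Lemma Alt_sub_all_c3 G : 4 < #|T| ->
  (forall a b d, uniq [:: a; b; d] -> c3 a b d \in G) -> 'Alt_T \subset G.
Proof.
move=> n5 H; have /simpleP [_ simp] := simple_Alt5 n5.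
have [a [b [c abc]]] : exists a b c : T, uniq [:: a; b; c].
  have := enum_uniq T; have := cardE T; case: (enum T) n5 => [|a [|b [|c s]]] /=.
  - by move=> h e; rewrite e in h.
  - by move=> h e; rewrite e in h.
  - by move=> h e; rewrite e in h.
  move=> _ _; rewrite !inE !negb_or => /and4P[/and3P[ab ac _] /andP[bc _] _ _].
  by exists a, b, c; rewrite /= !inE negb_or ab ac bc.
pose N := <<c3 a b c ^: 'Sym_T>>.
have sub (K : {group {perm T}}) : (forall a b d, uniq [:: a; b; d] -> c3 a b d \in K) ->
  N \subset K.
  move=> HK; rewrite gen_subG; apply/subsetP => _ /imsetP [x _ ->].
  by rewrite c3J HK // -[[:: x a; _; _]]/(map x [:: a; b; c]) map_inj_uniq //; apply: perm_inj.
have NA : N \subset 'Alt_T by apply: sub; apply: c3_Alt.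
have nN : N <| 'Alt_T.
  rewrite /normal NA; apply: subset_trans (Alt_subset T) _.
  by apply: norms_gen; apply: class_norm.
have [N1|NE] := simp _ nN; last by move: (sub _ H); rewrite (NE : N = _).
have : c3 a b c \in N by rewrite mem_gen // class_refl.
rewrite (N1 : N = 1) => /set1P e.
have [|e1 _ _ _] := @c3E a b c => //.
by move: abc; rewrite /= !inE -{1}e1 e perm1 eqxx.
Qed.

Lemma Alt_sub_Alt_or_Sym G : 'Alt_T \subset G -> G :=: 'Alt_T \/ G :=: 'Sym_T.
Proof.
move=> sAG; have GS : G \subset 'Sym_T by apply/subsetP => x _; rewrite inE.
case: (leqP #|T| 1) => [n1|n1].
  right; apply/eqP; rewrite eqEcard GS card_Sym.
  by have -> : (#|T|)`! = 1%N; [case: #|T| n1 => [|[]] | apply: cardG_gt0].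
have i2 : #|'Sym_T : 'Alt_T| = 2 by apply: Alt_index.
have := Lagrange_index GS sAG; rewrite i2 => e.
have: (#|'Sym_T : G| %| 2) by rewrite -e dvdn_mulr.
have cA := Lagrange sAG; have cS := Lagrange GS.
case/(proj2 (primeP (isT : prime 2)))/orP => /eqP iG.
  by right; apply/eqP; rewrite eqEcard GS -cS iG muln1 leqnn.
left; apply/eqP; rewrite eq_sym eqEcard sAG -cA.
by move: e; rewrite iG -[RHS]muln1 => /eqP; rewrite eqn_pmul2l // => /eqP ->; rewrite muln1 leqnn.
Qed.
End ThreeCycles.

(** * Averages over a doubly transitive group *)

(** Each point of the orbit is the image of [u] under one coset of the stabilizer, so an average
    over G is an average over the orbit. Denominators are cleared to stay in nat. *)
Lemma sum_orbit (gT : finGroupType) (sT : finType) (to : {action gT &-> sT})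
    (G : {group gT}) (u : sT) (F : sT -> nat) :
  (#|orbit to G u| * \sum_(x in G) F (to u x) = #|G| * \sum_(v in orbit to G u) F v)%N.
Proof.
rewrite (partition_big (to u) [in orbit to G u]) => [|x Gx]; last exact: mem_orbit.
rewrite -(card_orbit_stab to G u) -mulnA; congr (_ * _)%N; rewrite big_distrr /=.
apply: eq_bigr => v uv.
rewrite (eq_bigr (fun=> F v)) => [|x /andP[_ /eqP -> //]].
rewrite sum_nat_cond_const; congr (_ * _)%N.
case/orbitP: uv => a Ga <-; have := amove_act to u (subsetT G) Ga.
move/(congr1 (fun A : {set gT} => #|A|)); rewrite card_rcoset => <-.
by apply: eq_card => x; rewrite !inE.
Qed.

Section PairAction.
Variable T : finType.
Implicit Types (G : {group {perm T}}).

Definition pair_act (p : T * T) (g : {perm T}) := (g p.1, g p.2).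

Fact pair_act_is_action : is_action setT pair_act.
Proof. by apply: is_total_action => [[a b]|[a b] g h]; rewrite /pair_act /= ?perm1 ?permM. Qed.

Definition pact := Action pair_act_is_action.

Lemma mem_orbit_pact G a b c d :
  reflect (exists2 g, g \in G & g a = c /\ g b = d) ((c, d) \in orbit pact G (a, b)).
Proof.
apply: (iffP imsetP) => [[g Gg [-> ->]]|[g Gg [<- <-]]]; by exists g.
Qed.

Lemma orbit_P_setT G a : [transitive G, on setT | 'P] -> orbit 'P G a = setT.
Proof. by move=> trG; apply: (atransP trG). Qed.

Lemma ttrans_pact G a b : [transitive^2 G, on setT | 'P] -> a != b ->
  orbit pact G (a, b) = [set p | p.1 != p.2].
Proof.
move=> trG ab; apply/setP => -[c d]; rewrite inE /=.
apply/mem_orbit_pact/idP => [[g _ [<- <-]]|cd]; first by rewrite (inj_eq perm_inj).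
have dt x y : x != y -> [tuple x; y] \in 2.-dtuple([set: T]).
  by move=> xy; rewrite inE /= inE xy /=; apply/subsetP => z _; rewrite inE.
have [g Gg e] := atransP2 trG (dt _ _ ab) (dt _ _ cd).
by exists g => //; case: e.
Qed.

Lemma sum_dpair (F : T -> T -> nat) :
  \sum_(p in [set p : T * T | p.1 != p.2]) F p.1 p.2 = \sum_c \sum_(d | d != c) F c d.
Proof. by rewrite pair_big_dep; apply: eq_bigl => p; rewrite inE eq_sym. Qed.

Lemma card_dpair : #|[set p : T * T | p.1 != p.2]| = (#|T| * #|T|.-1)%N.
Proof.
rewrite -sum1_card (sum_dpair (fun _ _ => 1%N)).
rewrite (eq_bigr (fun=> #|T|.-1)) => [|c _]; first by rewrite sum_nat_const.
by rewrite sum1dep_card -(cardC1 c); apply: eq_card => d; rewrite !inE.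
Qed.

(** For x uniform in a doubly transitive group, (x a, x b) is uniform over the pairs of distinct
    points. *)
Lemma pair_sum G a b (F : T -> T -> nat) : [transitive^2 G, on setT | 'P] -> a != b ->
  (#|T| * #|T|.-1 * \sum_(x in G) F (x a) (x b) =
   #|G| * \sum_c \sum_(d | d != c) F c d)%N.
Proof.
move=> trG ab; have := sum_orbit pact G (a, b) (fun p => F p.1 p.2).
by rewrite ttrans_pact // sum_dpair card_dpair.
Qed.

Lemma point_sum G a (F : T -> nat) : [transitive G, on setT | 'P] ->
  (#|T| * \sum_(x in G) F (x a) = #|G| * \sum_c F c)%N.
Proof.
move=> trG; have := sum_orbit 'P G a F; rewrite orbit_P_setT // cardsT.
by rewrite (eq_bigl (fun c : T => true) (I := T)) // => x; rewrite inE.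
Qed.

End PairAction.
Arguments pact {T}.

(** * Minimal degree of doubly transitive groups *)

Section Commutator.
Variable T : finType.
Implicit Types (g h x : {perm T}) (G : {group {perm T}}) (a b c d : T).

Lemma supp_out g a : a \notin supp g -> g a = a.
Proof. by rewrite inE negbK => /eqP. Qed.

Lemma mem_supp_perm g a : (g a \in supp g) = (a \in supp g).
Proof. by rewrite !inE (inj_eq perm_inj). Qed.

Lemma mem_supp_permV g a : (g^-1 a \in supp g) = (a \in supp g).
Proof. by rewrite -mem_supp_perm permKV. Qed.

Lemma supp_outV g a : a \notin supp g -> g^-1 a = a.
Proof. by move/supp_out => {1}<-; rewrite permK. Qed.

Lemma commE g h a : [~ g, h] a = h (g (h^-1 (g^-1 a))).
Proof. by rewrite /commg /conjg !permM. Qed.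

(** If none of a, g^-1 a and h^-1 a is moved by both g and h, then the two permutations commute at
    a. *)
Lemma supp_comm g h (K := supp g :&: supp h) :
  supp [~ g, h] \subset K :|: g @: K :|: h @: K.
Proof.
apply/subsetP => a; apply: contraLR; rewrite 2!in_setU !negb_or => /andP[/andP[nK ngK] nhK].
suff e : [~ g, h] a = a by rewrite inE e eqxx.
have im x : a \notin x @: K -> x^-1 a \notin K.
  by apply: contra => ?; apply/imsetP; exists (x^-1 a); rewrite // permKV.
rewrite commE; move/im: ngK; move/im: nhK; move: nK; rewrite !in_setI mem_supp_permV mem_supp_permV.
case: (boolP (a \in supp g)) => ag /=.
  move=> ah _ ngh; rewrite (supp_outV ngh) permKV; exact: supp_out.
move=> _; rewrite (supp_outV ag) => nhg _.
case: (boolP (a \in supp h)) => ah; last by rewrite (supp_outV ah) (supp_out ag) (supp_out ah).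
by move: nhg; rewrite ah andbT => nhg; rewrite (supp_out nhg) permKV.
Qed.

Lemma card_supp_comm g h : #|supp [~ g, h]| <= 3 * #|supp g :&: supp h|.
Proof.
apply: leq_trans (subset_leq_card (supp_comm g h)) _.
apply: leq_trans (leq_card_setU _ _) _; apply: leq_trans (leq_add (leq_card_setU _ _) (leqnn _)) _.
by rewrite !card_imset; [lia | apply: perm_inj..].
Qed.

Lemma comm_neq1 g h a : a \in supp h -> g a \notin supp h -> [~ g, h] != 1.
Proof.
move=> ah gah; apply/commgP => /permP /(_ a); rewrite !permM (supp_out gah) => /perm_inj e.
by move: ah; rewrite inE -e eqxx.
Qed.

(** The bound of [supp_comm] leaves only the points a, g a and h a. Conjugates in G whose supports
    meet in one point would thus put a 3-cycle into G. *)
Lemma comm_c3 g h a : supp g :&: supp h = [set a] ->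
  uniq [:: a; h a; g a] /\ [~ g, h] = c3 a (h a) (g a).
Proof.
move=> e; have : a \in [set a] by rewrite set11.
rewrite -e inE => /andP[ag ah].
have K y : y \in supp g -> y \in supp h -> y = a.
  by move=> yg yh; apply/set1P; rewrite -e inE yg.
have gaa : g a != a by move: ag; rewrite inE.
have haa : h a != a by move: ah; rewrite inE.
have gah : g a \notin supp h.
  by apply/negP => gah; move/eqP: gaa; apply; apply: K; rewrite ?mem_supp_perm.
have hag : h a \notin supp g.
  by apply/negP => hg; move/eqP: haa; apply; apply: K; rewrite ?mem_supp_perm.
have hga : h a != g a by apply/eqP => E; move: hag; rewrite E mem_supp_perm ag.
have u : uniq [:: a; h a; g a] by rewrite uniq3 // eq_sym.
split=> //; have [e1 e2 e3 e4] := c3E u.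
have g'ah : g^-1 a \notin supp h.
  apply/negP => g'ah; move/eqP: gaa; apply; rewrite -{2}(permKV g a) (K (g^-1 a)) //.
  by rewrite mem_supp_permV.
have h'ag : h^-1 a \notin supp g.
  apply/negP => h'ag; move/eqP: haa; apply; rewrite -{2}(permKV h a) (K (h^-1 a)) //.
  by rewrite mem_supp_permV.
apply/permP => y; rewrite commE.
have [->|ya] := eqVneq y a; first by rewrite e1 (supp_outV g'ah) permKV.
have [->|yh] := eqVneq y (h a).
  by rewrite e2 (supp_outV hag) permK (supp_out gah).
have [->|yg] := eqVneq y (g a).
  by rewrite e3 permK (supp_out h'ag) permKV.
rewrite e4 ?inE ?negb_or ?ya ?yh // -commE; apply: supp_out; apply/negP =>
  /(subsetP (supp_comm g h)).
by rewrite e !imset_set1 !inE (negPf ya) (negPf yh) (negPf yg).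
Qed.

End Commutator.

(** * Moments of the intersection of two conjugate supports *)

Section MinDeg2.
Variables (T : finType) (G : {group {perm T}}) (g : {perm T}).
Hypotheses (n5 : 4 < #|T|) (trG : [transitive^2 G, on setT | 'P]).
Hypothesis (nA : ~~ ('Alt_T \subset G)).
Hypotheses (Gg : g \in G) (g1 : g != 1).
Hypothesis gmin : forall h, h \in G -> h != 1 -> #|supp g| <= #|supp h|.

(* N x counts the points witnessing that g and g ^ x^-1 do not commute; if there is one, then
   their commutator is nontrivial and moves at most 3 k x points. *)
Let n := #|T|.
Let D := supp g.
Let m := #|D|.
Let k (x : {perm T}) := #|[set a in D | x a \in D]|.
Let N (x : {perm T}) := #|[set a in D | (x a \in D) && (x (g a) \notin D)]|.

(** Double transitivity conjugates one 3-cycle to 3-cycles through every ordered pair of points, and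
    these force Alt into G. *)
Lemma c3_notin a b c : uniq [:: a; b; c] -> c3 a b c \notin G.
Proof.
move=> abc; apply: contra nA => Gc; apply: Alt_sub_all_c3 => //; apply: all_c3 => p q pq.
have /andP [] := abc; rewrite inE negb_or => /andP[ab _] _.
have : (p, q) \in orbit pact G (a, b) by rewrite ttrans_pact // inE.
case/mem_orbit_pact => x Gx [xp xq]; exists (x c); rewrite -xp -xq -c3J groupJ //; split => //.
by rewrite -[[:: x a; _; _]]/(map x [:: a; b; c]) map_inj_uniq //; apply: perm_inj.
Qed.

Lemma supp_conjV x a : (a \in supp (g ^ x^-1)) = (x a \in D).
Proof. by rewrite !inE -{1 2}(permK x a) permJ (inj_eq perm_inj). Qed.

Lemma supp_meet_conjV x : supp g :&: supp (g ^ x^-1) = [set a in D | x a \in D].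
Proof. by apply/setP => a; rewrite in_setI supp_conjV [in RHS]inE. Qed.

(** An intersection in a single point is excluded because the commutator would be a 3-cycle. *)
Lemma escape_bounds x : x \in G -> 0 < N x -> (1 < k x) && (m <= 3 * k x).
Proof.
move=> Gx /card_gt0P [a]; rewrite inE => /and3P[aD xaD xgD].
have GC : [~ g, g ^ x^-1] \in G by rewrite groupR // groupJ // groupV.
have C1 : [~ g, g ^ x^-1] != 1 by apply: (comm_neq1 (a := a)); rewrite supp_conjV.
apply/andP; split; last by apply: leq_trans (gmin GC C1) _;
  rewrite /k -supp_meet_conjV card_supp_comm.
have: 0 < k x by apply/card_gt0P; exists a; rewrite inE aD.
rewrite leq_eqVlt => /orP [/eqP kx|//]; rewrite /k -supp_meet_conjV in kx.
have /cards1P [b Kb] : #|supp g :&: supp (g ^ x^-1)| == 1%N by rewrite -kx.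
by have [u e] := comm_c3 Kb; move: (c3_notin u); rewrite -e GC.
Qed.

Lemma escape_le_meet x : N x <= k x.
Proof. by apply: subset_leq_card; apply/subsetP => a; rewrite !inE => /and3P[-> ->]. Qed.

Lemma sum_bool_card (P : pred T) (F : T -> bool) : (\sum_(a | P a) F a)%N = #|[set a | P a && F a]|.
Proof.
rewrite -sum1_card big_mkcond [in RHS]big_mkcond /=; apply: eq_bigr => a _.
by rewrite inE; case: (P a); case: (F a).
Qed.

(** First moment: for random x the two supports meet in m^2 / n points on average. *)
Lemma sum_meet : (n * \sum_(x in G) k x = #|G| * (m * m))%N.
Proof.
have tr1 : [transitive G, on setT | 'P] by apply: ntransitive1 trG.
rewrite (eq_bigr (fun x : {perm T} => \sum_(a in D) (x a \in D))%N) => [|x _]; last first.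
  by rewrite (sum_bool_card [in D] (fun a => x a \in D)).
rewrite exchange_big /= big_distrr /= (eq_bigr (fun=> #|G| * m)%N) => [|a _].
  by rewrite sum_nat_const -/m mulnCA.
rewrite (point_sum a (fun c => (c \in D) : nat) tr1); congr (_ * _)%N.
by rewrite (sum_bool_card predT) /m; apply: eq_card => c; rewrite inE.
Qed.

(** A point a of [D] differs from g a, so (x a, x (g a)) is a uniform pair of distinct points. *)
Lemma sum_escape : (n * n.-1 * \sum_(x in G) N x = #|G| * (m * (m * (n - m))))%N.
Proof.
rewrite (eq_bigr (fun x : {perm T} => \sum_(a in D) ((x a \in D) && (x (g a) \notin D)))%N) =>
  [|x _]; last first.
  by rewrite (sum_bool_card [in D] (fun a => (x a \in D) && (x (g a) \notin D))).
rewrite exchange_big /= big_distrr /= (eq_bigr (fun=> #|G| * (m * (n - m)))%N) => [|a aD].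
  by rewrite sum_nat_const -/m mulnCA.
rewrite (pair_sum (fun c d => ((c \in D) && (d \notin D)) : nat) trG); last first.
  by move: aD; rewrite inE eq_sym.
congr (_ * _)%N.
rewrite (bigID [in D]) /= [X in (_ + X)%N]big1 => [|c /negPf cD]; last by rewrite big1 // => d _;
  rewrite cD.
rewrite addn0 (eq_bigr (fun=> n - m)%N) ?sum_nat_const // => c cD.
have -> : (n - m)%N = #|~: D| by rewrite cardsCs setCK.
rewrite sum_bool_card.
apply: eq_card => d; rewrite in_setC [LHS]inE cD /=; apply: andb_idl.
by apply: contraNneq => ->.
Qed.

(** Second factorial moment of [k], from which its variance follows. *)
Lemma sum_meet_pairs : (n * n.-1 * \sum_(x in G) k x * (k x).-1 = #|G| * (m * m.-1 * (m * m.-1)))%N.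
Proof.
have e (x : {perm T}) : (k x * (k x).-1 =
    \sum_(a in D) \sum_(b | (b \in D) && (b != a)) ((x a \in D) && (x b \in D)))%N.
  rewrite -sum_nat_const [RHS](bigID (fun a => x a \in D)) /=.
  rewrite [X in (_ + X)%N]big1 => [|a /andP[_ /negPf xa]]; last by rewrite big1 // => b _;
    rewrite xa.
  rewrite addn0; apply: eq_big => [a|a]; first by rewrite inE.
  rewrite inE => /andP[aD xaD]; rewrite sum_bool_card xaD /k (cardsD1 a) inE aD xaD /=.
  by apply: eq_card => b; rewrite in_setD1 [RHS]inE -andbA [in RHS]andbCA; congr (_ && _);
    rewrite inE.
rewrite (eq_bigr _ (fun x _ => e x)) exchange_big /= big_distrr /=.
rewrite (eq_bigr (fun=> #|G| * (m.-1 * (m * m.-1)))%N) => [|a aD].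
  by rewrite sum_nat_const -/m mulnCA -!mulnA.
rewrite exchange_big /= big_distrr /= (eq_bigr (fun=> #|G| * (m * m.-1))%N) => [|b /andP[bD ba]].
  rewrite sum_nat_cond_const (_ : #|_| = m.-1); first by rewrite mulnCA.
  by rewrite /m (cardsD1 a D) aD /=; apply: eq_card => b; rewrite in_setD1 [LHS]inE andbC.
rewrite (pair_sum (fun c d => ((c \in D) && (d \in D)) : nat) trG); last by rewrite eq_sym.
congr (_ * _)%N.
rewrite (bigID [in D]) /= [X in (_ + X)%N]big1 => [|c /negPf cD]; last by rewrite big1 // => d _;
  rewrite cD.
rewrite addn0 (eq_bigr (fun=> m.-1)%N) ?sum_nat_const // => c cD.
rewrite sum_bool_card /m (cardsD1 c D) cD.
by apply: eq_card => d; rewrite in_setD1 [LHS]inE.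
Qed.

Lemma supp_gt0 : 0 < m.
Proof.
apply/card_gt0P; case: (pickP [in D]) => [a aD|D0]; first by exists a.
move/eqP: g1 => []; apply/permP => a; rewrite perm1; apply: supp_out.
by have /= -> := D0 a.
Qed.

(** Whenever N x > 0, the bound 1 < k x gives N x <= k x (k x - 1); the means are then compared.
    This crude bound of order sqrt n excludes very small m in the sharper argument. *)
Lemma min_degree_sqrt : n - m <= m.-1 * m.-1.
Proof.
have G0 := cardG_gt0 G; have M0 := supp_gt0.
have : (#|G| * (m * (m * (n - m))) <= #|G| * (m * m.-1 * (m * m.-1)))%N.
  rewrite -sum_escape -sum_meet_pairs leq_mul2l; apply/orP; right; apply: leq_sum => x Gx.
  case: (posnP (N x)) => [->//|/(escape_bounds Gx)/andP[k1 _]].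
  by apply: leq_trans (escape_le_meet x) _; rewrite -[leqLHS]muln1 leq_mul2l; lia.
by rewrite leq_pmul2l // -!mulnA leq_pmul2l // [(m.-1 * _)%N]mulnCA leq_pmul2l.
Qed.

End MinDeg2.

(** * Real inequalities behind the bound n / 3 - (2 / 3) sqrt n *)

Section MinDegReal.
Import Order.TTheory GRing.Theory Num.Theory.
Local Open Scope ring_scope.
Variable R : realFieldType.

(** The identity t (k - b)^2 - k (t - b)^2 = (k - t) (t k - b^2) shows that (k - b)^2 / k increases
    beyond |b|. The count N is thus dominated by a quadratic in k, whose mean is known from two
    moments. *)
Lemma quad_minorant (t b k N : R) : 0 <= t -> b ^+ 2 <= t ^+ 2 -> N <= k -> t <= k ->
  N * (t - b) ^+ 2 <= t * (k - b) ^+ 2.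
Proof.
move=> t0 bt Nk tk; have h1 : N * (t - b) ^+ 2 <= k * (t - b) ^+ 2 by rewrite ler_wpM2r // sqr_ge0.
apply: le_trans h1 _; have : 0 <= (k - t) * (t * k - b ^+ 2) by rewrite mulr_ge0 ?subr_ge0 //; nra.
by lra.
Qed.
(** For n <= 4 m, the square of n - 3 m exceeds 4 n, the square of 2 s, which is too much; here the
    term (2 / 3) sqrt n arises. For smaller m, n - 3 m > n / 4 forces m <= 48. *)
Lemma min_degree_cases (m n s : R) : s ^+ 2 = n -> 48 <= s -> 48 < m -> 3 * m < n - 2 * s ->
  m * n * (n - 3 * m) ^+ 2 + 9 * m * (n - m) ^+ 2 <= 3 * n ^+ 2 * (n - m) -> False.
Proof.
move=> sn s48 m48 lt key.
have n0 : 0 < n by lra.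
have [m4|m4] := leP n (4 * m).
  have h1 : 4 * n <= (n - 3 * m) ^+ 2.
    have -> : 4 * n = (2 * s) ^+ 2 by rewrite -sn; ring.
    by rewrite ler_sqr ?nnegrE; lra.
  have h2 : m * n * (4 * n) <= m * n * (n - 3 * m) ^+ 2 by rewrite ler_wpM2l // mulr_ge0; lra.
  have {h1 h2 key} h3 : 0 <= 3 * n ^+ 3 - 16 * m * n ^+ 2 + 18 * m ^+ 2 * n - 9 * m ^+ 3.
    by move: key h2; lra.
  (* At y = 0, that is m = n / 4, the cubic in [h3] equals - n^3 / 64, and it decreases with m. *)
  have [y yE] : exists y, y = 4 * m - n by exists (4 * m - n).
  have y0 : 0 <= y by lra.
  have my : m = (n + y) / 4 by rewrite yE; field.
  have yn : y <= n by lra.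
  move: h3; rewrite my; clear - y0 yn n0 => h3.
  have n3 : 0 < n ^+ 3 by rewrite exprn_gt0.
  have ny : y ^+ 2 * n <= n ^+ 2 * y by nra.
  have ny2 : 0 <= n * y ^+ 2 by apply: mulr_ge0; [exact: ltW | exact: sqr_ge0].
  have y3 : 0 <= y ^+ 3 by rewrite exprn_ge0.
  have ny3 : 0 <= n ^+ 2 * y by apply: mulr_ge0; [exact: sqr_ge0 |].
  by lra.
have h1 : (n / 4) ^+ 2 <= (n - 3 * m) ^+ 2 by rewrite ler_sqr ?nnegrE; lra.
have h2 : m * n * (n / 4) ^+ 2 <= m * n * (n - 3 * m) ^+ 2 by rewrite ler_wpM2l // mulr_ge0; lra.
have h3 : 0 <= m * (n - m) ^+ 2 by apply: mulr_ge0; [lra | exact: sqr_ge0].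
have h4 : 0 <= n ^+ 2 * m by apply: mulr_ge0; [exact: sqr_ge0 | lra].
have h5 : m * n ^+ 3 <= 48 * n ^+ 3 by move: key h2; lra.
by move: h5; rewrite ler_pM2r ?exprn_gt0 // leNgt m48.
Qed.

(** The last hypothesis is the mean over G of [quad_minorant] with t = m / 3, multiplied by n (n -
    1). The best b turns it into e^2 + v <= t (n - m) / n, where e = m (n - 3 m) / (3 n) and v is
    the variance of the intersection size. *)
Lemma min_degree_algebra (m n s : R) : s ^+ 2 = n -> 48 <= s -> 1 <= m -> m <= n ->
  n - m <= (m - 1) ^+ 2 ->
  (forall b : R, b ^+ 2 <= (m / 3) ^+ 2 ->
    m ^+ 2 * (n - m) * (m / 3 - b) ^+ 2 <=
    (m / 3) * (m ^+ 2 * (m - 1) ^+ 2 + (1 - 2 * b) * (m ^+ 2 * (n - 1)) + b ^+ 2 * (n * (n - 1)))) ->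
  n - 2 * s <= 3 * m.
Proof.
move=> sn s48 m1 mn low H; rewrite leNgt; apply/negP => lt.
have n48 : 48 ^+ 2 <= n by rewrite -sn ler_sqr ?nnegrE //; lra.
have sn48 : 48 * s <= n by rewrite -sn; nra.
have m48 : 48 < m.
  rewrite ltNge; apply/negP => m48; suff : (m - 1) ^+ 2 <= 47 ^+ 2 by move: low n48; lra.
  by rewrite ler_sqr ?nnegrE; lra.
(* a and v are the mean and the variance of the size of the intersection of two conjugate
   supports; b = a - v / (t - a) is the optimal centre in the proof of Cantelli's inequality. *)
pose t := m / 3; pose a := m ^+ 2 / n; pose v := m ^+ 2 * (n - m) ^+ 2 / (n ^+ 2 * (n - 1)).
pose e := t - a; pose S := m ^+ 2 * (n - m) / (n * (n - 1)).
have n0 : n != 0 by rewrite gt_eqF //; lra.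
have n10 : n - 1 != 0 by rewrite gt_eqF //; lra.
have e0 : 0 < e.
  rewrite /e /t /a subr_gt0 ltr_pdivrMr; last lra.
  by rewrite expr2 -mulrA ltr_pM2l; lra.
have S0 : 0 < S by rewrite /S divr_gt0 // mulr_gt0 // ?exprn_gt0 //; lra.
have vE : v = S * ((n - m) / n) by rewrite /v /S; field; rewrite n0 n10.
have v0 : 0 < v by rewrite vE mulr_gt0 // divr_gt0; lra.
have t0 : 0 < t by rewrite /t; lra.
have a0 : 0 < a by rewrite /a divr_gt0 // ?exprn_gt0; lra.
(* This makes the centre a - w admissible, that is, at least - t. *)
have vt : v <= t ^+ 2 - a ^+ 2.
  rewrite /t /a /v -subr_ge0.
  have -> : (m / 3) ^+ 2 - (m ^+ 2 / n) ^+ 2 - m ^+ 2 * (n - m) ^+ 2 / (n ^+ 2 * (n - 1)) =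
     m ^+ 2 / (n ^+ 2 * (n - 1)) * ((n ^+ 2 / 9 - m ^+ 2) * (n - 1) - (n - m) ^+ 2).
    by field; rewrite n0 n10.
  apply: mulr_ge0; first by apply: divr_ge0; [exact: sqr_ge0 | apply: mulr_ge0; [exact: sqr_ge0
    | lra]].
  have h1 : 2 / 9 * (s * n) <= n ^+ 2 / 9 - m ^+ 2 by nra.
  have h2 : 2 / 9 * (s * n) * (n - 1) <= (n ^+ 2 / 9 - m ^+ 2) * (n - 1) by rewrite ler_wpM2r //;
    lra.
  have h3 : (n - m) ^+ 2 <= n ^+ 2 by rewrite ler_sqr ?nnegrE; lra.
  suff : n ^+ 2 <= 2 / 9 * (s * n) * (n - 1) by move: h2 h3; lra.
  have : 10 * n <= s * n by rewrite ler_pM2r; lra.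
  nra.
pose w := v / e; have w0 : 0 < w by rewrite divr_gt0.
have we : w * e = v by rewrite /w divfK // gt_eqF.
have wta : w <= t + a by rewrite ler_pdivrMr // /e; move: vt; lra.
have et : e = t - a by [].
have bt : (a - w) ^+ 2 <= t ^+ 2.
  rewrite -subr_ge0 subr_sqr mulr_ge0 //; move: e0 w0 wta; rewrite et; lra.
have key : S * (e + w) ^+ 2 <= t * (v + w ^+ 2).
  have nn0 : 0 < n * (n - 1) by rewrite mulr_gt0 //; lra.
  rewrite -(ler_pM2l nn0); have := H _ bt; rewrite -/t.
  have -> : t - (a - w) = e + w by rewrite et; ring.
  congr (_ <= _); first by rewrite /S; field; rewrite n0 n10.
  by rewrite /v /a; field; rewrite n0 n10.
(* Since w e = v, the right-hand side of [key] is t w (e + w), and one factor cancels. *)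
have key2 : S * (e + w) <= t * w.
  have ew : 0 < e + w by lra.
  rewrite -(ler_pM2r ew); move: key; rewrite -we; lra.
have key3 : e ^+ 2 + v <= t * ((n - m) / n).
  rewrite -(ler_pM2l S0); have h : S * (e + w) * e <= t * (w * e) by rewrite mulrA ler_pM2r.
  have -> : S * (t * ((n - m) / n)) = t * v by rewrite vE; ring.
  by rewrite we in h; rewrite -[v in leLHS]we; move: h; lra.
have low_v : m ^+ 2 * (n - m) ^+ 2 / n ^+ 3 <= v.
  rewrite /v -subr_ge0.
  have -> : m ^+ 2 * (n - m) ^+ 2 / (n ^+ 2 * (n - 1)) - m ^+ 2 * (n - m) ^+ 2 / n ^+ 3 =
     m ^+ 2 * (n - m) ^+ 2 / (n ^+ 3 * (n - 1)) by field; rewrite n0 n10.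
  have c1 : 0 <= n ^+ 3 * (n - 1) by apply: mulr_ge0; [apply: exprn_ge0; lra | lra].
  by apply: divr_ge0 => //; apply: mulr_ge0; exact: sqr_ge0.
have key4 : m * n * (n - 3 * m) ^+ 2 + 9 * m * (n - m) ^+ 2 <= 3 * n ^+ 2 * (n - m).
  have c0 : 0 < m / (9 * n ^+ 3).
    by apply: divr_gt0; [lra | apply: mulr_gt0; [lra | apply: exprn_gt0; lra]].
  rewrite -(ler_pM2l c0).
  have -> : m / (9 * n ^+ 3) * (m * n * (n - 3 * m) ^+ 2 + 9 * m * (n - m) ^+ 2) =
     e ^+ 2 + m ^+ 2 * (n - m) ^+ 2 / n ^+ 3 by rewrite et /t /a; field.
  have -> : m / (9 * n ^+ 3) * (3 * n ^+ 2 * (n - m)) = t * ((n - m) / n) by rewrite /t; field.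
  by move: key3 low_v; lra.
exact: (min_degree_cases sn s48 m48 lt key4).
Qed.

End MinDegReal.

Section MinDegTwoTransitive.
Import Order.TTheory GRing.Theory Num.Theory.
Local Open Scope ring_scope.
Variables (R : realFieldType) (T : finType) (G : {group {perm T}}).
Hypotheses (trG : [transitive^2 G, on setT | 'P]).
Hypothesis (nA : ~~ ('Alt_T \subset G)).

Lemma min_degree_ttrans (s : R) (h : {perm T}) : s ^+ 2 = #|T|%:R -> 48 <= s ->
  h \in G -> h != 1%g -> #|T|%:R - 2 * s <= 3 * #|supp h|%:R.
Proof.
move=> sn s48 Gh h1.
have n48 : (47 < #|T|)%N by rewrite -(ltr_nat R) -sn; nra.
have Ph : (h \in G) && (h != 1%g) by rewrite Gh.
pose g := [arg min_(g < h | (g \in G) && (g != 1%g)) #|supp g|]%N.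
have [Gg g1 gmin] : [/\ g \in G, g != 1%g &
    forall x, x \in G -> x != 1%g -> (#|supp g| <= #|supp x|)%N].
  by rewrite /g; case: arg_minnP => // i /andP[? ?] H; split=> // x Gx x1; apply: H; rewrite Gx.
suff : #|T|%:R - 2 * s <= 3 * #|supp g|%:R.
  by move/le_trans; apply; rewrite ler_pM2l // ler_nat gmin.
have n5 : (4 < #|T|)%N by lia.
pose n := #|T|; pose m := #|supp g|.
have m0 : (0 < m)%N by apply: supp_gt0 g1.
have mn : (m <= n)%N by exact: max_card.
apply: min_degree_algebra => //.
- by rewrite ler1n.
- by rewrite ler_nat.
- have := min_degree_sqrt n5 trG nA Gg g1 gmin; rewrite -(ler_nat R) natrB // natrM.
  by rewrite -/m -(prednK m0) /= -addn1 natrD addrK expr2.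
move=> b bt; have G0 : 0 < #|G|%:R :> R by rewrite ltr0n cardG_gt0.
have predR (p : nat) : (0 < p)%N -> p.-1%:R = p%:R - 1 :> R.
  by move=> p0; rewrite -subn1 natrB.
have n0 : (0 < n)%N by lia.
have := congr1 (fun z => z%:R : R) (sum_meet g trG).
have := congr1 (fun z => z%:R : R) (sum_meet_pairs g trG).
have := congr1 (fun z => z%:R : R) (sum_escape g trG).
rewrite -/n -/m !natrM !predR // natrB // !natr_sum.
set SN := \sum_(x in G) _; set SK := \sum_(x in G) _; set S := \sum_(x in G) _.
move=> eN eK eS.
(* Sum of the pointwise bounds: where N = 0 the left side vanishes, elsewhere k >= m / 3. *)
have tot : (m%:R / 3 - b) ^+ 2 * SN <= m%:R / 3 * (SK + (1 - 2 * b) * S + b ^+ 2 * #|G|%:R).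
  have -> : b ^+ 2 * #|G|%:R = \sum_(x in G) b ^+ 2 by rewrite sumr_const mulr_natr.
  rewrite /SN /SK /S !mulr_sumr -!big_split /= mulr_sumr; apply: ler_sum => x Gx.
  set k := #|[set a in _ | x a \in _]|; set N := #|[set a in _ | _ & _]|.
  have -> : (k * k.-1)%N%:R = k%:R * (k%:R - 1) :> R.
    by rewrite natrM; case: (posnP k) => [->|k0]; [rewrite !mul0r|rewrite predR].
  have -> : k%:R * (k%:R - 1) + (1 - 2 * b) * k%:R + b ^+ 2 = (k%:R - b) ^+ 2 :> R by ring.
  case: (posnP N) => [->|N0]; first by rewrite mulr0 mulr_ge0 ?sqr_ge0 // divr_ge0.
  rewrite mulrC; apply: quad_minorant => //.
  - by rewrite divr_ge0.
  - by rewrite ler_nat; apply: escape_le_meet.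
  - have := escape_bounds n5 trG nA Gg gmin Gx N0 => /andP[_]; rewrite -(ler_nat R) natrM.
    by move=> h3; rewrite ler_pdivrMr // mulrC.
rewrite -(ler_pM2r G0).
have nn : 0 <= n%:R * (n%:R - 1) :> R by rewrite mulr_ge0 // subr_ge0 ler1n.
have := ler_wpM2r nn tot.
rewrite -/n -/m.
have -> : (m%:R / 3 - b) ^+ 2 * SN * (n%:R * (n%:R - 1)) = 
  (m%:R / 3 - b) ^+ 2 * (n%:R * (n%:R - 1) * SN) by ring.
rewrite eN.
have -> : m%:R / 3 * (SK + (1 - 2 * b) * S + b ^+ 2 * #|G|%:R) * (n%:R * (n%:R - 1)) =
  m%:R / 3 * (n%:R * (n%:R - 1) * SK + (1 - 2 * b) * (n%:R - 1) * (n%:R * S) + b ^+ 2 * #|G|%:R * (n%:R * (n%:R - 1))) by ring.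
by rewrite eK eS; congr (_ <= _); ring.
Qed.
End MinDegTwoTransitive.

(** * Order of doubly transitive groups *)

Section PointStabilizers.
Variable T : finType.
Implicit Types (G H K : {group {perm T}}) (A : {set T}).

Lemma stab_setU1 G A x : 'C_G(x |: A | 'P) = 'C_('C_G(A | 'P))[x | 'P].
Proof. by rewrite astabU setIA setIAC. Qed.

Lemma index_stab_setU1 G A x :
  #|G : 'C_G(x |: A | 'P)| = (#|G : 'C_G(A | 'P)| * #|orbit 'P 'C_G(A | 'P) x|)%N.
Proof.
by rewrite stab_setU1 card_orbit Lagrange_index ?subsetIl.
Qed.

Lemma index_stab_le G A : #|G : 'C_G(A | 'P)| <= #|T| ^ #|A|.
Proof.
move: {2}#|A| (erefl #|A|) => k; elim: k A => [|k IH] A cA.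
  move/eqP: cA; rewrite cards_eq0 => /eqP ->.
  rewrite cards0 expn0 (_ : 'C_G(set0 | 'P) = G) ?indexgg //.
  by apply/setIidPl/subsetP => g _; apply/astabP => x; rewrite inE.
have /card_gt0P [x xA] : 0 < #|A| by rewrite cA.
rewrite -(setD1K xA) index_stab_setU1 cardsU1 !inE eqxx /= add1n expnSr.
by rewrite leq_mul ?max_card // IH //; move: cA; rewrite (cardsD1 x) xA => -[].
Qed.

(** A potential that vanishes only for the trivial group. Intersecting with well-chosen conjugates
    of a subgroup without very large orbits decreases it geometrically. *)
Definition orbit_pairs H : {set T * T} := [set p | (p.1 != p.2) && (p.2 \in orbit 'P H p.1)].

Lemma orbit_pairs0 H : orbit_pairs H = set0 -> H :=: 1.
Proof.
move=> e; apply/trivgP/subsetP => h Hh; apply/set1P/permP => a; rewrite perm1.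
apply/eqP; apply: contraT => ha; suff : (a, h a) \in orbit_pairs H by rewrite e inE.
by rewrite inE /= eq_sym ha; apply: (mem_orbit 'P).
Qed.

Lemma card_orbit_pairs_le H : #|orbit_pairs H| <= #|T| * #|T|.
Proof. by apply: leq_trans (max_card _) _; rewrite card_prod. Qed.

End PointStabilizers.

(** * Bases from few conjugates of a subgroup without very large orbits *)

Section CoverStep.
Variables (T : finType) (G C : {group {perm T}}) (u w : nat).
Hypotheses (trG : [transitive^2 G, on setT | 'P]) (n1 : 1 < #|T|).
Hypotheses (uw : u < w) (orbC : forall x, w * #|orbit 'P C x| <= u * #|T|).

Let F (c d : T) := (d \in orbit 'P C c) : nat.

(** Given the image c of a, the image of b is uniform over the other n - 1 points, and (o - 1) / (n
    - 1) <= o / n for an orbit of size o. *)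
Lemma pair_sum_le a b : a != b -> w * \sum_(x in G) F (x a) (x b) <= u * #|G|.
Proof.
move=> ab; have nn : 0 < #|T| * #|T|.-1 by rewrite muln_gt0; lia.
rewrite -(leq_pmul2l nn) mulnCA (pair_sum F trG ab) mulnCA.
have -> : (#|T| * #|T|.-1 * (u * #|G|) = #|G| * (#|T| * #|T|.-1 * u))%N by ring.
rewrite leq_mul2l; apply/orP; right; rewrite big_distrr /=.
rewrite (_ : _ * _ * u = \sum_(c : T) #|T|.-1 * u)%N; last by rewrite sum_nat_const mulnA.
apply: leq_sum => c _; have oc := orbC c.
rewrite (sum_bool_card _ (fun d => d \in orbit 'P C c)).
have -> : #|[set a | (a != c) & a \in orbit 'P C c]| = #|orbit 'P C c|.-1.
  rewrite (cardsD1 c (orbit 'P C c)) orbit_refl /=; apply: eq_card => d.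
  by rewrite in_setD1 [LHS]inE.
have o0 : 0 < #|orbit 'P C c| by apply/card_gt0P; exists c; apply: orbit_refl.
by nia.
Qed.

(** A pair stays in one orbit of the intersection only if [x] maps it into one orbit of [C]; some
    [x] does at least as well as the average. *)
Lemma cover_step (H : {group {perm T}}) : H \subset G ->
  exists2 x, x \in G & w * #|orbit_pairs (H :&: C :^ x^-1)| <= u * #|orbit_pairs H|.
Proof.
move=> HG; apply/exists_inP; apply: contraT; rewrite negb_exists_in => /forall_inP no.
have : \sum_(x in G) (u * #|orbit_pairs H|).+1 <= \sum_(x in G) w * #|orbit_pairs (H :&: C :^ x^-1)|.
  by apply: leq_sum => x Gx; rewrite ltnNge no.
rewrite sum_nat_const leqNgt => /negP []; rewrite -big_distrr /=.
apply: (@leq_ltn_trans (w * \sum_(x in G) \sum_(p in orbit_pairs H) F (x p.1) (x p.2))%N).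
  rewrite leq_mul2l; apply/orP; right; apply: leq_sum => x Gx.
  rewrite (sum_bool_card [in orbit_pairs H] (fun p => x p.2 \in orbit 'P C (x p.1))).
  apply: subset_leq_card; apply/subsetP => -[a b]; rewrite !inE /=.
  case/andP=> ab /imsetP [h /setIP [Hh Ch] /= e]; rewrite {1}/aperm in e.
  rewrite ab; apply/andP; split; first by apply/imsetP; exists h.
  move: Ch; rewrite mem_conjg invgK => Ch; apply/imsetP; exists (h ^ x) => //=.
  by rewrite /aperm permJ e.
rewrite exchange_big /= big_distrr /=.
apply: (@leq_ltn_trans (\sum_(p in orbit_pairs H) u * #|G|)%N).
  by apply: leq_sum => p; rewrite inE => /andP[pp _]; apply: pair_sum_le.
rewrite sum_nat_const (_ : _ * _ = #|G| * (u * #|orbit_pairs H|))%N; last by ring.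
by rewrite ltn_pmul2l ?cardG_gt0.
Qed.

Lemma cover_steps M K : #|G : C| <= M -> C \subset G ->
  exists H : {group {perm T}}, [/\ H \subset G, #|G| <= #|H| * M ^ K &
    w ^ K * #|orbit_pairs H| <= u ^ K * (#|T| * #|T|)].
Proof.
move=> CM CG; elim: K => [|K [H [HG GH WH]]].
  by exists G; rewrite !expn0 !mul1n muln1 card_orbit_pairs_le.
have [x Gx Wx] := cover_step HG; exists (H :&: C :^ x^-1)%G => /=.
split; first by rewrite subIset ?HG.
  apply: leq_trans GH _; rewrite expnS mulnA leq_mul2r; apply/orP; right.
  have CxG : C :^ x^-1 \subset G by rewrite -(conjGid (groupVr Gx)) conjSg.
  have C0 := cardG_gt0 C; rewrite -(leq_pmul2r C0).
  have -> : (#|H| * #|C| = #|H| * #|(C :^ x^-1)%G|)%N by rewrite cardJg.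
  rewrite mul_cardG -mulnA [leqLHS]mulnC leq_mul2l; apply/orP; right.
  apply: (@leq_trans #|G|); first by apply: subset_leq_card; rewrite mul_subG.
  by rewrite -(Lagrange CG) mulnC leq_mul2r CM orbT.
rewrite !expnS -!mulnA [leqLHS]mulnCA.
apply: leq_trans (leq_mul (leqnn _) Wx) _.
by rewrite mulnCA leq_mul2l WH orbT.
Qed.

(** After K steps the potential is an integer below 1, so an intersection of K conjugates of [C] is
    trivial, while its index is at most M^K. *)
Lemma order_le_cover M K : #|G : C| <= M -> C \subset G ->
  u ^ K * (#|T| * #|T|) < w ^ K -> #|G| <= M ^ K.
Proof.
move=> CM CG uwK; have [H [HG GH WH]] := cover_steps K CM CG.
suff H1 : H :=: 1 by rewrite H1 cards1 mul1n in GH.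
apply: orbit_pairs0; apply/eqP; rewrite -cards_eq0 -leqn0 -ltnS.
rewrite -(ltn_pmul2l (_ : 0 < w ^ K)) ?muln1 ?(leq_ltn_trans WH) //.
by rewrite expn_gt0; lia.
Qed.

End CoverStep.

(** * Large orbits on tuples and induced symmetric groups *)

Section TupleAction.
Variables (I T : finType).
Implicit Types (G : {group {perm T}}).

Definition ffun_act (t : {ffun I -> T}) (g : {perm T}) : {ffun I -> T} := [ffun i => g (t i)].

Fact ffun_act_is_action : is_action setT ffun_act.
Proof.
by apply: is_total_action => [t|t g h]; apply/ffunP => i; rewrite !ffunE ?perm1 ?permM.
Qed.

Definition tuple_act := Action ffun_act_is_action.

Lemma stab_ffun_act G (t : {ffun I -> T}) : 'C_G[t | tuple_act] = 'C_G([set t i | i : I] | 'P).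
Proof.
apply/setP => g; rewrite in_setI [RHS]in_setI; case: (g \in G) => //=.
apply/astab1P/astabP => [/= e _ /imsetP [i _ ->]|H] /=.
  by move/ffunP/(_ i): e; rewrite ffunE.
by apply/ffunP => i; rewrite ffunE; apply: (H (t i)); apply: imset_f.
Qed.

(* Both the orbit and its image under reindexing by s fill more than half of T^I, so they meet. *)
Lemma large_orbit_reindex G (t : {ffun I -> T}) (s : I -> I) : injective s ->
  #|T| ^ #|I| < 2 * #|orbit tuple_act G t| -> exists2 g, g \in G & forall i, g (t i) = t (s i).
Proof.
move=> s_inj big.
pose phi (v : {ffun I -> T}) : {ffun I -> T} := [ffun i => v (s i)].
have phi_inj : injective phi.
  move=> v w /ffunP e; apply/ffunP => i; have [s' sK s'K] := injF_bij s_inj.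
  by have := e (s' i); rewrite !ffunE s'K.
have /set0Pn [_ /setIP [/imsetP [b Gb ->] /imsetP [_ /imsetP [a Ga ->] e]]] :
    orbit tuple_act G t :&: phi @: orbit tuple_act G t != set0.
  rewrite -card_gt0; have := cardsUI (orbit tuple_act G t) (phi @: orbit tuple_act G t).
  rewrite (card_imset _ phi_inj) addnn -mul2n => e.
  have : #|orbit tuple_act G t :|: phi @: orbit tuple_act G t| <= #|T| ^ #|I|.
    by rewrite -card_ffun max_card.
  by lia.
exists (b * a^-1) => [|i]; first by rewrite groupM ?groupV.
by rewrite permM; move/ffunP/(_ i): e; rewrite !ffunE /= => ->; rewrite permK.
Qed.

End TupleAction.
Arguments tuple_act {I T}.

(** Bernoulli's inequality (1 - 1/N)^k >= 1 - k/N at N = 3 l and k = l gives 2/3, which exceeds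
    1/2. *)
Lemma bernoulli_half l : 0 < l -> (3 * l) ^ l < 2 * (3 * l - 1) ^ l.
Proof.
move=> l0; have B k N : 0 < N -> N ^ k * (N - k) <= (N - 1) ^ k * N.
  move=> N0; elim: k => [|k IH]; first by rewrite !expn0 subn0.
  rewrite !expnSr; have := leq_mul (leqnn (N - 1)) IH.
  have [kN|kN] := leqP N k.+1; first by move=> _; rewrite (_ : N - k.+1 = 0)%N ?muln0 //; lia.
  have : N * (N - k.+1) <= (N - 1) * (N - k) by nia.
  move/(leq_mul (leqnn (N ^ k))); lia.
have := B l (3 * l)%N; rewrite (_ : 3 * l - l = 2 * l)%N; last by lia.
have e0 : 0 < (3 * l) ^ l by rewrite expn_gt0; lia.
nia.
Qed.

(** Let l = |I|. If the first alternative fails, points can be added one at a time, each from an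
    orbit of more than (1 - 1/(3 l)) n points. The orbit of the resulting l-tuple then contains more
    than half of all l-tuples, and [large_orbit_reindex] applies. *)
Lemma small_stab_or_reindex (T : finType) (G : {group {perm T}}) (I : finType) :
  0 < #|I| -> 1 < #|T| ->
  (exists2 A : {set T}, #|A| < #|I| &
     forall x, 3 * #|I| * #|orbit 'P 'C_G(A | 'P) x| <= (3 * #|I| - 1) * #|T|) \/
  (exists2 t : I -> T, injective t &
     forall s : I -> I, injective s -> exists2 g, g \in G & forall i, g (t i) = t (s i)).
Proof.
set l := #|I| => l0 n1.
case: (pickP (fun A : {set T} => (#|A| < l) &&
    [forall x, 3 * l * #|orbit 'P 'C_G(A | 'P) x| <= (3 * l - 1) * #|T|])) =>
      [A /andP [Al /forallP H]|no].
  by left; exists A.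
right.
have chain k : k <= l -> exists2 A : {set T}, #|A| = k &
    ((3 * l - 1) * #|T|) ^ k <= #|G : 'C_G(A | 'P)| * (3 * l) ^ k.
  elim: k => [|k IH] kl.
    by exists set0; rewrite ?cards0 // !expn0 muln1 indexg_gt0.
  have [A Ak HA] := IH (ltnW kl).
  have /forallPn [x] : ~~ [forall x, 3 * l * #|orbit 'P 'C_G(A | 'P) x| <= (3 * l - 1) * #|T|].
    by have := no A; rewrite Ak kl /= => ->.
  rewrite -ltnNge => xb; have xA : x \notin A.
    apply/negP => xA; have o1 : orbit 'P 'C_G(A | 'P) x = [set x].
      apply/setP => y; rewrite inE; apply/imsetP/eqP => [[g /setIP [_ /astabP gA] ->]|->].
        exact: gA.
      by exists 1; rewrite ?act1.
    by move: xb; rewrite o1 cards1; nia.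
  exists (x |: A); first by rewrite cardsU1 xA Ak.
  rewrite index_stab_setU1 !expnSr.
  have := leq_mul HA (ltnW xb); move/leq_trans; apply.
  by rewrite leq_eqVlt; apply/orP; left; apply/eqP; ring.
have [A Al HA] := chain l (leqnn l).
have eA : #|I| = #|A| by rewrite Al.
pose t := [ffun i : I => enum_val (cast_ord eA (enum_rank i))].
have t_inj : injective t.
  by move=> i j; rewrite !ffunE => /enum_val_inj /cast_ord_inj /enum_rank_inj.
have tA : [set t i | i : I] = A.
  apply/eqP; rewrite eqEcard card_imset // -eA leqnn andbT.
  by apply/subsetP => _ /imsetP [i _ ->]; rewrite ffunE enum_valP.
exists t => // s s_inj; apply: large_orbit_reindex => //.
rewrite card_orbit stab_ffun_act tA -/l.
have c0 : 0 < (3 * l) ^ l by rewrite expn_gt0; lia.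
rewrite -(ltn_pmul2r c0) -mulnA.
apply: leq_trans (leq_mul (leqnn 2) HA).
rewrite [(((_ - _) * _) ^ l)%N]expnMn mulnA [(#|T| ^ l * _)%N]mulnC ltn_pmul2r;
  first exact: bernoulli_half.
by rewrite expn_gt0; lia.
Qed.

(** * Elements with cycles of many coprime lengths *)

Section CycleLengths.
Variable T : finType.
Implicit Types (g : {perm T}).

Lemma perm_fix_dvd g e x : ((g ^+ e) x == x) = (#|porbit g x| %| e).
Proof.
have L0 : 0 < #|porbit g x| by apply/card_gt0P; exists x; apply: porbit_id.
have per k : (g ^+ (k * #|porbit g x|)) x = x.
  elim: k => [|k IH]; first by rewrite expg0 perm1.
  by rewrite mulSn expgD permM [(g ^+ #|_|) _]permX iter_porbit.
rewrite {1}(divn_eq e #|porbit g x|) expgD permM per.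
have [d0|d0] := posnP (e %% #|porbit g x|).
  by rewrite d0 expg0 perm1 eqxx /dvdn d0.
rewrite /dvdn; rewrite [RHS](gtn_eqF d0); apply/negP => /eqP fx.
have := uniq_traject_porbit g x => /(@nth_uniq _ x) U.
have := U 0 (e %% #|porbit g x|); rewrite size_traject ltn_mod L0 => /(_ isT isT).
move: fx; rewrite permX !nth_traject ?ltn_mod // => -> /=; rewrite eqxx eq_sym => /esym.
by rewrite (gtn_eqF d0).
Qed.

Lemma porbit_dvd_order g x : #|porbit g x| %| #[g].
Proof. by rewrite -perm_fix_dvd expg_order perm1. Qed.

(** Cycle lengths divide the order of g, so the exponent absorbs their part prime to p and up to a
    factors p. A cycle that is not killed needs one more factor p. *)
Lemma prime_power_power g p a : prime p -> ~~ (p ^ a.+1 %| #[g]`_p^' * p ^ a) /\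
  forall x, (g ^+ (#[g]`_p^' * p ^ a)) x != x -> p ^ a.+1 %| #|porbit g x|.
Proof.
move=> pp; have p1 := prime_gt1 pp; split.
  rewrite Gauss_dvdr; first by rewrite dvdn_Pexp2l // ltnn.
  by rewrite coprimeXl // prime_coprime // -p'natE // part_pnat.
move=> x; rewrite perm_fix_dvd => ndvd.
have L0 : 0 < #|porbit g x| by apply/card_gt0P; exists x; apply: porbit_id.
rewrite pfactor_dvdn // ltnNge; apply: contra ndvd => la.
rewrite -(partnC p L0) mulnC; apply: dvdn_mul.
  by apply: partn_dvd; [apply: order_gt0 | apply: porbit_dvd_order].
by rewrite p_part dvdn_exp2l.
Qed.

End CycleLengths.

Section CyclicShift.
Variables (r : nat) (q : 'I_r -> nat).
Let I := {j : 'I_r & 'I_(q j)}.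

(** A permutation with one cycle of each length [q j], to be realised by an element of G on the
    points of a tuple. *)
Definition blockwise_shift (u : I) : I := Tagged (fun j => 'I_(q j)) (ordS (tagged u)).

Lemma blockwise_shift_inj : injective blockwise_shift.
Proof.
move=> [j a] [j' b] /eqP; rewrite /blockwise_shift -tag_eqE /tag_eq /= => /andP [/eqP jj].
case: j' / jj b => b; rewrite tagged_asE => /eqP /(bij_inj (@ordS_bij _)) ->; reflexivity.
Qed.

Lemma iter_blockwise_shift e j (a : 'I_(q j)) : exists2 b : 'I_(q j),
  iter e blockwise_shift (Tagged _ a) = Tagged (fun j => 'I_(q j)) b & val b = (a + e) %% q j.
Proof.
elim: e => [|e [b /= -> eb]]; first by exists a; rewrite ?addn0 ?modn_small.
by exists (ordS b) => //=; rewrite eb addnS -addn1 modnDml addn1.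
Qed.

End CyclicShift.

Lemma prod_coprime_dvdn (J : eqType) (s : seq J) (q : J -> nat) L : uniq s ->
  {in s &, forall i j, i != j -> coprime (q i) (q j)} -> (forall j, j \in s -> q j %| L) ->
  \prod_(j <- s) q j %| L.
Proof.
elim: s => [|i s IH]; first by rewrite big_nil dvd1n.
rewrite cons_uniq big_cons => /andP[is_ us] cop dv.
rewrite Gauss_dvd; last first.
  rewrite big_seq; apply: (big_ind (coprime (q i))) => [|x y|j js].
  - exact: coprimen1.
  - by rewrite coprimeMr => -> ->.
  - by apply: cop; rewrite ?inE ?eqxx ?js ?orbT //; apply: contraNneq is_ => ->.
rewrite dv ?mem_head // IH // => [x y xs ys|x xs]; first by apply: cop; rewrite inE ?xs ?ys orbT.
by rewrite dv // inE xs orbT.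
Qed.

Section NoLargeSymmetricSection.
Variables (T : finType) (G : {group {perm T}}).
Hypothesis mindeg : forall h, h \in G -> h != 1 -> #|T| <= 4 * #|supp h|.
Variables (r : nat) (p a : 'I_r -> nat).
Hypotheses (p_prime : forall j, prime (p j)) (p_inj : injective p).
Let q j := (p j ^ (a j).+1)%N.
Let I := {j : 'I_r & 'I_(q j)}.
Variable (t : I -> T).
Hypotheses (t_inj : injective t)
  (t_reindex : forall s : I -> I, injective s -> exists2 g, g \in G & forall i, g (t i) = t (s i)).

(* Each q j divides the lengths of the cycles of g through at least a quarter of the points, so on
   average a quarter of the q j divide the length of the cycle through a point. *)
Lemma prime_power_reindex_bound Q k : 0 < #|T| -> 0 < Q -> (forall j, Q <= q j) -> 4 * k <= r ->
  Q ^ k <= #|T|.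
Proof.
move=> n0 Q0 Qq kr; have [g Gg gt] := t_reindex (@blockwise_shift_inj r q).
have q0 j : 0 < q j by rewrite expn_gt0 prime_gt0.
(* On the tuple [t], g acts as the blockwise shift, so its order is a multiple of every [q j]. This
   makes the powers of g used in [big] nontrivial. *)
have ge e j : g ^+ e = 1 -> q j %| e.
  move=> ge1; pose z := Ordinal (q0 j).
  have [b eb vb] := iter_blockwise_shift e z.
  have : t (iter e (@blockwise_shift r q) (Tagged _ z)) = t (Tagged _ z).
    transitivity ((g ^+ e) (t (Tagged _ z))); last by rewrite ge1 perm1.
    by rewrite permX; elim: (e) => //= e' <-; rewrite gt.
  move/t_inj; rewrite eb => /eqP; rewrite eq_Tagged => /eqP /= bz.
  by move: vb; rewrite bz /= add0n /dvdn => <-.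
pose L x := #|porbit g x|.
have big j : #|T| <= 4 * #|[set x | q j %| L x]|.
  have [nd H] := prime_power_power g (a j) (p_prime j).
  apply: leq_trans (mindeg (groupX (#[g]`_(p j)^' * p j ^ a j) Gg) _) _.
    by apply: contra nd => /eqP; apply: ge.
  rewrite leq_mul2l; apply/orP; right; apply: subset_leq_card.
  by apply/subsetP => x; rewrite !inE; apply: H.
case: (posnP k) => [->|k0]; first by rewrite expn0.
have /existsP [x xk] : [exists x, k <= #|[set j | q j %| L x]|].
  apply: contraT => /existsPn no.
  have : \sum_(j : 'I_r) #|T| <= \sum_(j : 'I_r) 4 * #|[set x | q j %| L x]|.
    by apply: leq_sum => j _.
  rewrite sum_nat_const card_ord -big_distrr /=.
  have -> : \sum_(j < r) #|[set x | q j %| L x]| = \sum_x #|[set j | q j %| L x]|.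
    under eq_bigr do rewrite -(sum_bool_card predT).
    by rewrite exchange_big /=; apply: eq_bigr => x _; rewrite (sum_bool_card predT).
  have : \sum_x #|[set j | q j %| L x]| <= \sum_(x : T) k.-1.
    by apply: leq_sum => x _; have := no x; rewrite -ltnNge; lia.
  rewrite sum_nat_const; set S := \sum_x _ => h1 h2.
  have : 4 * k * #|T| <= 4 * (#|T| * k.-1).
    apply: (@leq_trans (r * #|T|)); first by rewrite leq_mul2r kr orbT.
    by apply: leq_trans h2 _; rewrite leq_mul2l h1 orbT.
  by rewrite -{1}(prednK k0); nia.
set J := [set j | _] in xk.
have : \prod_(j <- enum J) q j %| L x.
  apply: prod_coprime_dvdn => [|i j _ _ ij|j]; first exact: enum_uniq.
    rewrite coprimeXl // coprimeXr // prime_coprime // dvdn_prime2 //.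
    by apply: contra ij => /eqP /p_inj ->.
  by rewrite mem_enum inE.
move/dvdn_leq => /(_ _); have L0 : 0 < L x by apply/card_gt0P; exists x; apply: porbit_id.
move/(_ L0) => le; apply: leq_trans (leq_trans le (max_card _)).
apply: (@leq_trans (Q ^ #|J|)); first by rewrite leq_pexp2l.
rewrite big_enum /= -prod_nat_const; exact: leq_prod.
Qed.

End NoLargeSymmetricSection.

Lemma card_tagged_ord r (q : 'I_r -> nat) : #|{: {j : 'I_r & 'I_(q j)}}| = \sum_(j < r) q j.
Proof.
rewrite card_tagged sumnE big_map big_enum /=.
by apply: eq_bigr => j _; rewrite card_ord.
Qed.

(* Any 40 distinct primes would do: by prime_power_reindex_bound, a point of a set of size n would
   lie in a cycle whose length is divisible by 10 coprime numbers of order n^(1/5). *)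
Definition small_primes := [seq p <- iota 2 172 | prime p].

Lemma size_small_primes : size small_primes = 40. Proof. by vm_compute. Qed.

(** Here z is the integer part of n^(1/5), and the index set has 40 blocks whose sizes are prime
    powers in (z / 174, z]. If G realised all its permutations, ten blocks would give (z %/ 180)^10
    <= n < (z + 1)^5, which is false for z >= 200^2. So the stabilizer of fewer than l points has no
    orbit containing almost all points. *)
Lemma order_ttrans_cover (T : finType) (G : {group {perm T}}) z :
  [transitive^2 G, on setT | 'P] ->
  (forall h, h \in G -> h != 1 -> #|T| <= 4 * #|supp h|) ->
  200 * 200 <= z -> z ^ 5 <= #|T| < z.+1 ^ 5 ->
  exists2 l, 0 < l <= 40 * z &
    forall K, (3 * l - 1) ^ K * (#|T| * #|T|) < (3 * l) ^ K -> #|G| <= (#|T| ^ l) ^ K.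
Proof.
move=> trG mindeg z4 /andP [zn nz].
have n1 : 1 < #|T|.
  by apply: leq_trans zn; apply: (@leq_trans z); [lia | by rewrite -{1}(expn1 z) leq_pexp2l //;
    lia].
pose p (j : 'I_40) := nth 0 small_primes j.
have szj (j : 'I_40) : j < size small_primes by rewrite size_small_primes.
have pP j : prime (p j) && (p j < 174).
  have := mem_nth 0 (szj j); rewrite mem_filter mem_iota => /andP [-> /andP [_ h]].
  exact: h.
have p_prime j : prime (p j) by case/andP: (pP j).
have p174 j : p j < 174 by case/andP: (pP j).
have p_inj : injective p.
  move=> i j /eqP; rewrite nth_uniq ?szj ?filter_uniq ?iota_uniq //.
  by move/eqP/val_inj.
have z0 : 0 < z by lia.
(* [q j] is to be the largest power of [p j] up to z; its exponent is the successor of [a j]. *)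
pose a j := (trunc_log (p j) z).-1.
have aE j : (a j).+1 = trunc_log (p j) z.
  rewrite /a prednK // trunc_log_gt0 prime_gt1 //=; have := p174 j; lia.
pose q j := (p j ^ (a j).+1)%N.
have qz j : q j <= z by rewrite /q aE trunc_logP // prime_gt1.
have zq j : z < 174 * q j.
  have := trunc_log_ltn z (prime_gt1 (p_prime j)); rewrite -aE expnS => h.
  by apply: leq_trans h _; rewrite leq_mul2r ltnW ?orbT // p174.
have q0 j : 0 < q j by rewrite expn_gt0 prime_gt0.
pose I := {j : 'I_40 & 'I_(q j)}.
have lz : #|{: I}| <= 40 * z.
  rewrite card_tagged_ord (_ : 40 * z = \sum_(j < 40) z)%N; last by rewrite sum_nat_const card_ord.
  by apply: leq_sum => j _.
have l0 : 0 < #|{: I}|.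
  by apply/card_gt0P; exists (Tagged (fun j => 'I_(q j)) (Ordinal (q0 ord0))).
exists #|{: I}|; first by rewrite l0.
move=> K HK; case: (small_stab_or_reindex G l0 n1) => [[A Al orbA]|[t t_inj t_re]]; last first.
  have := prime_power_reindex_bound mindeg p_prime p_inj t_inj t_re (Q := (z %/ 180)%N) (k := 10).
  move=> H; have : (z %/ 180) ^ 10 <= #|T|.
    by apply: H => //; [lia | lia | move=> j; have := zq j; rewrite -/(q j); lia].
  rewrite leqNgt => /negP []; apply: leq_trans nz _.
  rewrite (expnM _ 2 5) leq_exp2r //.
  have : z %/ 180 * 180 + 179 >= z by lia.
  rewrite -mulnn; set Q := (z %/ 180)%N; nia.
have CG : 'C_G(A | 'P) \subset G by apply: subsetIl.
have l3 : 3 * #|{: I}| - 1 < 3 * #|{: I}| by lia.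
apply: (order_le_cover trG n1 l3 orbA _ CG HK).
apply: leq_trans (index_stab_le G A) _.
by rewrite leq_pexp2l // ltnW.
Qed.

(** * Uniprimitive groups *)

Lemma card_bigcup_le (I T : finType) (A : {set I}) (F : I -> {set T}) :
  #|\bigcup_(i in A) F i| <= \sum_(i in A) #|F i|.
Proof.
apply: (big_ind2 (fun (X : {set T}) m => #|X| <= m)) => [|X m Y m' Xm Ym|//]; first
  by rewrite cards0.
by apply: leq_trans (leq_card_setU _ _) _; apply: leq_add.
Qed.

Section Primitive.
Variables (T : finType) (G : {group {perm T}}).
Hypothesis primG : [primitive G, on setT | 'P].

Let trG : [transitive G, on setT | 'P]. Proof. by case/andP: primG. Qed.

Lemma trans_ex a b : exists2 g, g \in G & g a = b.
Proof. by have [g Gg ->] := atransP2 trG (in_setT a) (in_setT b); exists g. Qed.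

(** The elements of G moving a within its class form a subgroup that contains the stabilizer of a,
    which is maximal. *)
Lemma primitive_equivalence (e : rel T) a b : equivalence_rel e ->
  (forall g c d, g \in G -> e (g c) (g d) = e c d) -> a != b -> e a b -> forall c d, e c d.
Proof.
move=> /equivalence_relP [er et] einv ab eab.
pose H := [set g in G | e a (g a)].
have gH : group_set H.
  apply/group_setP; split; first by rewrite inE group1 perm1 er.
  move=> g h; rewrite !inE => /andP[Gg eg] /andP[Gh eh]; rewrite groupM //= permM.
  by rewrite (et _ _ eh) einv.
have sCH : 'C_G[a | 'P] \subset Group gH.
  apply/subsetP => g /setIP [Gg /astab1P ga]; rewrite inE Gg.
  by rewrite -[g a]/(aperm a g) [aperm _ _]ga er.
have sHG : Group gH \subset G by apply/subsetP => g; rewrite inE => /andP[].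
have := primG; rewrite (trans_prim_astab (in_setT a) trG) => /maximal_eqP [_ /(_ _ sCH sHG)].
case=> [HC|HG].
  have [g Gg ga] := trans_ex a b.
  have : g \in Group gH by rewrite inE Gg ga.
  rewrite HC => /setIP [_ /astab1P] /=; rewrite -[aperm a g]/(g a) ga => ba.
  by rewrite ba eqxx in ab.
have ea c : e a c.
  have [g Gg <-] := trans_ex a c.
  by have := Gg; rewrite -HG inE => /andP[].
by move=> c d; rewrite -(et _ _ (ea c)).
Qed.

(** Connectedness of a nontrivial invariant graph. Not being separated by any edge-closed set is an
    invariant equivalence relation; it takes the place of being joined by a path. *)
Lemma primitive_closed (e : rel T) (a b : T) (S : {set T}) : symmetric e ->
  (forall g c d, g \in G -> e (g c) (g d) = e c d) -> a != b -> e a b ->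
  (forall c d, e c d -> c \in S -> d \in S) -> forall c d, c \in S -> d \in S.
Proof.
move=> es einv ab eab Scl.
pose cl (S : {set T}) := [forall c, forall d, e c d ==> (c \in S) ==> (d \in S)].
pose f c d := [forall S : {set T}, cl S ==> ((c \in S) == (d \in S))].
have clP (X : {set T}) : reflect (forall c d, e c d -> c \in X -> d \in X) (cl X).
  apply: (iffP forallP) => [H c d ecd cX|H c].
    by have /forallP/(_ d) := H c; rewrite ecd cX.
  by apply/forallP => d; apply/implyP => ecd; apply/implyP; apply: H.
have fP c d : reflect (forall X, cl X -> (c \in X) = (d \in X)) (f c d).
  apply: (iffP forallP) => [H X cX|H X]; first by have := H X; rewrite cX => /eqP.
  by apply/implyP => /H ->.
have ff : forall c d, f c d.
  apply: (@primitive_equivalence f a b) => //.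
  - apply/equivalence_relP; split=> [c|c d /fP H x]; first exact/fP.
    by apply/fP/fP => H' X cX; rewrite -?H' ?H.
  - have half g c d : g \in G -> f c d -> f (g c) (g d).
      move=> Gg /fP H; apply/fP => X /clP cX.
      have := H (g @^-1: X); rewrite !inE; apply; apply/clP => p q epq; rewrite !inE.
      by apply: cX; rewrite einv.
    move=> g c d Gg; apply/idP/idP; last exact: half.
    by move/(half _ _ _ (groupVr Gg)); rewrite !permK.
  by apply/fP => X /clP cX; apply/idP/idP; apply: cX; rewrite // es.
by move=> c d cS; have /fP/(_ S) := ff c d; rewrite cS => <- //; apply/clP.
Qed.

End Primitive.

(** * Points distinguished by orbitals *)

Section Distinguish.
Variables (T : finType) (G : {group {perm T}}).
Implicit Types (a b c : T) (g : {perm T}).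

Definition dis a b := [set c | (b, c) \notin orbit pact G (a, c)].

Lemma orbit_pact_act g a b (p : T * T) : g \in G ->
  ((g a, g b) \in orbit pact G p) = ((a, b) \in orbit pact G p).
Proof. by move=> Gg; rewrite -[(g a, g b)]/(pact (a, b) g) orbit_actr. Qed.

Lemma orbit_pact_actl g a b (p : T * T) : g \in G ->
  (p \in orbit pact G (g a, g b)) = (p \in orbit pact G (a, b)).
Proof. by move=> Gg; rewrite ![p \in _]orbit_sym orbit_pact_act. Qed.

Lemma disC a b : dis a b = dis b a.
Proof. by apply/setP => c; rewrite !inE orbit_sym. Qed.

Lemma dis_refl a : dis a a = set0.
Proof. by apply/setP => c; rewrite !inE orbit_refl. Qed.

Lemma dis_tri a b c : dis a c \subset dis a b :|: dis b c.
Proof.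
apply/subsetP => d; rewrite !inE; apply: contraR; rewrite negb_or !negbK => /andP [h1 h2].
exact: orbit_trans h2 h1.
Qed.

Lemma dis_act g a b : g \in G -> dis (g a) (g b) = g @: dis a b.
Proof.
move=> Gg; apply/setP => c; rewrite -(permKV g c) mem_imset //; last exact: perm_inj.
by rewrite !inE orbit_pact_act ?orbit_pact_actl.
Qed.

Lemma card_dis_act g a b : g \in G -> #|dis (g a) (g b)| = #|dis a b|.
Proof. by move=> Gg; rewrite dis_act // card_imset //; apply: perm_inj. Qed.

(** If g fixes c, it maps (a, c) to (g a, c). Lower bounds for [dis] thus become lower bounds for
    the minimal degree. *)
Lemma dis_sub_supp g a : g \in G -> dis a (g a) \subset supp g.
Proof.
move=> Gg; apply/subsetP => c; rewrite !inE; apply: contra => /eqP gc.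
by rewrite -{1}gc; apply: (mem_orbit pact).
Qed.

Hypothesis primG : [primitive G, on setT | 'P].
Hypothesis ntrG : ~~ [transitive^2 G, on setT | 'P].

Lemma ttrans_of_orbit a b : a != b ->
  (forall c d, c != d -> (c, d) \in orbit pact G (a, b)) -> [transitive^2 G, on setT | 'P].
Proof.
move=> ab H; apply/imsetP; exists [tuple a; b].
  by rewrite !inE /= inE ab; apply/subsetP => z; rewrite inE.
apply/setP => t; apply/idP/imsetP => [|[g Gg ->]]; last first.
  rewrite inE /= inE (inj_eq perm_inj) ab /=; by apply/subsetP => z; rewrite inE.
case/tupleP: t => c t; case/tupleP: t => d t; rewrite (tuple0 t) inE /= inE.
case/andP => /andP [cd _] _; have /mem_orbit_pact [g Gg [gc gd]] := H c d cd.
by exists g => //; apply/val_inj; rewrite /= /aperm gc gd.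
Qed.

(** Let w be n minus the largest valency of a nondiagonal orbital. Counting the pairs (y, z) such
    that z distinguishes x and y gives some y with |dis x y| >= w. Moreover n <= w^2, because w sets
    of size w cover T. *)
Lemma exists_large_dis : 1 < #|T| -> exists a b, #|T| <= #|dis a b| ^ 2.
Proof.
move=> n1; have /card_gt0P [x _] : 0 < #|T| by lia.
have /card_gt1P [y0 [y1 [_ _ y01]]] : 1 < #|[set: T]| by rewrite cardsT.
have [z1 z1x] : exists z, z != x.
  by case: (eqVneq y0 x) y01 => [->|]; [exists y1; rewrite eq_sym | exists y0].
pose f z := #|[set y | (y, z) \notin orbit pact G (x, z)]|.
pose z0 := [arg min_(z < z1 | z != x) f z].
have [z0x fmin] : z0 != x /\ forall z, f z0 <= f z.
  rewrite /z0; case: arg_minnP => // z zx H; split=> // z'.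
  have [->|] := eqVneq z' x; last exact: H.
  apply: (@leq_trans #|T|.-1); last first.
    rewrite -(cardC1 x); apply: subset_leq_card; apply/subsetP => y; rewrite !inE => yx.
    by apply/mem_orbit_pact => -[g _ [e1 e2]]; rewrite -e1 e2 eqxx in yx.
  rewrite -(cardC1 x); apply: subset_leq_card; apply/subsetP => y; rewrite !inE.
  by apply: contra => /eqP ->; rewrite orbit_refl.
pose w := f z0.
have [y yw] : exists y, w <= #|dis x y|.
  apply/existsP; apply: contraT => /existsPn no.
  have : \sum_y #|dis x y| = \sum_z f z.
    under eq_bigr do rewrite -(sum_bool_card predT).
    by rewrite exchange_big; apply: eq_bigr => z _; rewrite (sum_bool_card predT).
  have : \sum_(z : T) w <= \sum_z f z by apply: leq_sum => z _.
  have : \sum_y #|dis x y| <= \sum_(y : T) w.-1.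
    by apply: leq_sum => y _; have := no y; rewrite -ltnNge; lia.
  have : 0 < w by have := no x; rewrite -ltnNge; lia.
  rewrite !sum_nat_const => w0 h1 h2 h3.
  have : #|T| * w <= #|T| * w.-1 by apply: leq_trans h2 _; rewrite -h3.
  by rewrite leq_pmul2l; lia.
exists x, y; apply: (@leq_trans (w ^ 2)); last by rewrite leq_exp2r.
(* O is an orbital of maximal valency and M its complement: M composed with itself contains O,
   since otherwise M would be an invariant equivalence relation. *)
pose O := orbit pact G (x, z0).
pose M u := [set y | (y, u) \notin O].
have Minv g u v : g \in G -> (g u \in M (g v)) = (u \in M v).
  by move=> Gg; rewrite !inE orbit_pact_act.
have Mw u : #|M u| = w.
  have [g Gg <-] := trans_ex primG z0 u.
  rewrite /w /f -[RHS](card_imset _ (@perm_inj _ g)); apply: eq_card => v.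
  by rewrite -(permKV g v) Minv // mem_imset //; apply: perm_inj.
have Mrefl u : u \in M u.
  rewrite inE; apply/mem_orbit_pact => -[g _ [e1 e2]].
  by move: z0x; rewrite -(inj_eq (@perm_inj _ g)) e1 e2 eqxx.
have cover u v : exists2 c, c \in M u & v \in M c.
  apply/exists_inP; apply: contraT; rewrite negb_exists_in => /forall_inP no.
  have vu : (v, u) \in O.
    by apply: contraT => vu; have := no u (Mrefl u); rewrite inE vu.
  have Mtr a b c : b \in M a -> c \in M b -> c \in M a.
    move=> ba cb; rewrite inE; apply/negP => ca.
    have : (c, a) \in orbit pact G (v, u) by apply: (orbit_trans ca); rewrite orbit_sym.
    case/mem_orbit_pact => g Gg [gv gu].
    move: ba cb; rewrite -gv -gu -(permKV g b) !Minv // => ba cb.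
    by have := no _ ba; rewrite cb.
  have Meq a b : b \in M a -> M b = M a.
    move=> ba; apply/eqP; rewrite eqEcard !Mw leqnn andbT.
    by apply/subsetP => c; apply: Mtr.
  pose e a b := b \in M a.
  have eqe : equivalence_rel e.
    apply/equivalence_relP; split=> [c|c d cd c']; first exact: Mrefl.
    by rewrite /e (Meq _ _ cd).
  have einv g c d : g \in G -> e (g c) (g d) = e c d by move=> Gg; rewrite /e Minv.
  case: (boolP [exists c, exists d, (c != d) && e c d]) =>
    [/existsP [c /existsP [d /andP [cd ecd]]]|ne].
    have := primitive_equivalence primG eqe einv cd ecd z0 x.
    by rewrite /e inE /O orbit_refl.
  case/negP: ntrG; apply: (@ttrans_of_orbit x z0); first by rewrite eq_sym.
  move=> c d cd; apply: contraT => ncd; case/negP: ne; apply/existsP; exists d.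
  by apply/existsP; exists c; rewrite eq_sym cd /e inE.
have : [set: T] \subset \bigcup_(c in M x) M c.
  by apply/subsetP => v _; have [c cu vc] := cover x v; apply/bigcupP; exists c.
move/subset_leq_card; rewrite cardsT => /leq_trans; apply.
apply: leq_trans (card_bigcup_le _ _) _.
by rewrite (eq_bigr (fun=> w)) // sum_nat_const Mw.
Qed.

(* Let E be the orbital graph of (a, b), of valency k.  Every point is distinguished by some edge
   at a, so n <= k D.  If two points are at distance 3, their neighbourhoods are disjoint and
   distinguish them, so 2 k <= 3 D; otherwise #|dis u v| <= 2 D for all u and v. *)
Lemma card_dis_ge a b : a != b -> #|T| <= 4 * #|dis a b| ^ 2.
Proof.
move=> ab; pose D := #|dis a b|; rewrite -/D.
have n1 : 1 < #|T| by rewrite -cardsT; apply/card_gt1P; exists a, b; rewrite !inE.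
pose E x y := ((x, y) \in orbit pact G (a, b)) || ((y, x) \in orbit pact G (a, b)).
have Es : symmetric E by move=> x y; rewrite /E orbC.
have Einv g x y : g \in G -> E (g x) (g y) = E x y by move=> Gg; rewrite /E !orbit_pact_act.
have Eab : E a b by rewrite /E orbit_refl.
have ED x y : E x y -> #|dis x y| = D.
  case/orP => /mem_orbit_pact [g Gg [<- <-]]; first exact: card_dis_act.
  by rewrite disC card_dis_act.
pose N x := [set y | E x y]; pose k := #|N a|.
have Nk x : #|N x| = k.
  have [g Gg <-] := trans_ex primG a x.
  rewrite /k -[RHS](card_imset _ (@perm_inj _ g)); apply: eq_card => y.
  by rewrite -(permKV g y) (mem_imset _ _ (@perm_inj _ g)) [LHS]inE Einv // [RHS]inE.
have closed := primitive_closed primG Es Einv ab Eab.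
have nkD : #|T| <= k * D.
  have : [set: T] \subset \bigcup_(y in N a) dis a y.
    apply/subsetP => z _; apply: contraT => nz.
    have all_orb y : E a y -> (y, z) \in orbit pact G (a, z).
      move=> Eay; apply: contraT => yz; case/negP: nz; apply/bigcupP; exists y; by rewrite inE.
    (* If every neighbour of a were in the same orbital relation to z as a, then the set [S] of all
       points in this relation would be closed under edges, hence contain z itself as well as b. *)
    pose S := [set w | (w, z) \in orbit pact G (a, z)].
    have SE c d : E c d -> c \in S -> d \in S.
      move=> Ecd; rewrite !inE => /mem_orbit_pact [g Gg [ga gz]].
      rewrite -{1}gz -(permKV g d) orbit_pact_act //; apply: all_orb.
      by rewrite -(Einv g) // ga permKV.
    have aS : a \in S by rewrite inE orbit_refl.
    have zS := closed S SE a z aS; have bS := closed S SE a b aS.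
    move: zS; rewrite inE => /mem_orbit_pact [g Gg [ga gz]].
    have az : a = z by apply: (@perm_inj _ g); rewrite ga gz.
    move: bS; rewrite inE -az => /mem_orbit_pact [h Hh [e1 e2]].
    by move: ab; rewrite -e1 e2 eqxx.
  move/subset_leq_card; rewrite cardsT => /leq_trans; apply.
  apply: leq_trans (card_bigcup_le _ _) _.
  rewrite (eq_bigr (fun=> D)) ?sum_nat_const // => y; rewrite inE => /ED //.
pose near u v := [exists w, ((w == u) || E u w) && ((w == v) || E w v)].
have D1 u w : (w == u) || E u w -> #|dis u w| <= D.
  by case/orP => [/eqP ->|/ED ->//]; rewrite dis_refl cards0.
have D2 u v : near u v -> #|dis u v| <= 2 * D.
  case/existsP => w /andP [uw wv]; apply: leq_trans (subset_leq_card (dis_tri u w v)) _.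
  apply: leq_trans (leq_card_setU _ _) _; rewrite mul2n -addnn leq_add ?D1 //.
  by rewrite eq_sym.
case: (boolP [forall u, forall v, near u v]) => [/forallP all2|].
  have [u [v uv]] := exists_large_dis n1.
  apply: leq_trans uv _; have /forallP/(_ v)/D2 := all2 u.
  rewrite -(@leq_exp2r _ _ 2) // => /leq_trans; apply.
  by rewrite expnMn.
rewrite negb_forall => /existsP [u]; rewrite negb_forall => /existsP [v nuv].
(* By connectedness, some edge leaves the ball of radius 2 about u; its end d is at distance 3. *)
have [c [d [uc cd nd]]] : exists c d, [/\ near u c, E c d & ~~ near u d].
  case: (boolP [exists c, exists d, [&& near u c, E c d & ~~ near u d]]).
    by case/existsP => c /existsP [d /and3P [? ? ?]]; exists c, d.
  move=> ne; case/negP: nuv.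
  have := closed [set v | near u v] _ u v; rewrite !inE; apply.
    move=> c d Ecd; rewrite !inE => uc; apply: contraT => ud; case/negP: ne.
    by apply/existsP; exists c; apply/existsP; exists d; rewrite uc Ecd ud.
  by apply/existsP; exists u; rewrite eqxx.
have D3 : #|dis u d| <= 3 * D.
  apply: leq_trans (subset_leq_card (dis_tri u c d)) _.
  apply: leq_trans (leq_card_setU _ _) _.
  by rewrite (_ : 3 * D = 2 * D + D)%N ?leq_add ?D2 ?D1 ?cd ?orbT //; lia.
have disj z : E u z -> ~~ E d z.
  move=> uz; apply: contra nd => dz; apply/existsP; exists z.
  by rewrite uz (Es z d) dz !orbT.
have orbE x y z : (y, z) \in orbit pact G (x, z) -> E x z = E y z.
  by case/mem_orbit_pact => g Gg [gx gz]; rewrite -gx -{2}gz Einv.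
have : N u :|: N d \subset dis u d.
  apply/subsetP => z; rewrite in_setU !inE => H; apply/negP => /orbE e.
  move: H; rewrite e orbb => dz; move: (dz); apply/negP/disj; by rewrite e.
move/subset_leq_card; rewrite cardsU (_ : N u :&: N d = set0); last first.
  by apply/setP => z; rewrite !inE; apply/negP => /andP [/disj /negPf ->].
rewrite cards0 subn0 !Nk => kk.
by have := leq_trans kk D3; nia.
Qed.

End Distinguish.

Section Undistinguished.
Variables (T : finType) (G : {group {perm T}}).
Implicit Types (A : {set T}).

(** Contains the pairs in one orbit of the pointwise stabilizer of A and, unlike the set of these
    pairs, is easy to control when a random point is added to A. *)
Definition undis A : {set T * T} :=
  [set p | (p.1 != p.2) && [disjoint A & dis G p.1 p.2]].

Lemma orbit_pairs_sub_undis A : orbit_pairs 'C_G(A | 'P) \subset undis A.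
Proof.
apply/subsetP => -[a b]; rewrite !inE /= => /andP [-> /imsetP [h /setIP [Gh /astabP hA] ->]] /=.
rewrite disjoint_subset; apply/subsetP => c cA; rewrite inE.
apply/negP => /(subsetP (dis_sub_supp a Gh)); rewrite inE.
by have /= := hA c cA; rewrite /aperm => ->; rewrite eqxx.
Qed.

Lemma sum_card_orbit A :
  \sum_x #|orbit 'P 'C_G(A | 'P) x| <= #|T| + #|undis A|.
Proof.
apply: (@leq_trans (#|T| + #|orbit_pairs 'C_G(A | 'P)|)); last first.
  by rewrite leq_add2l subset_leq_card ?orbit_pairs_sub_undis.
rewrite -(sum1_card (mem (orbit_pairs _))) (eq_bigl (fun p : T * T => (p.1 != p.2) &&
  (p.2 \in orbit 'P 'C_G(A | 'P) p.1))); last first.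
  by move=> p; rewrite inE.
rewrite -(pair_big_dep predT (fun c d => (c != d) && (d \in orbit 'P 'C_G(A | 'P) c)) (fun _ _ =>
  1%N)) /=.
rewrite -sum1_card -big_split /=; apply: leq_sum => x _.
rewrite sum1dep_card (cardsD1 x) orbit_refl leq_add2l.
by apply: subset_leq_card; apply/subsetP => y; rewrite in_setD1 inE eq_sym.
Qed.

(** A pair survives only if x avoids the points distinguishing it, of which there are at least d. *)
Lemma sum_card_undis A d : (forall a b, a != b -> d <= #|dis G a b|) ->
  \sum_x #|undis (x |: A)| <= (#|T| - d) * #|undis A|.
Proof.
move=> dP; have e x : #|undis (x |: A)| = \sum_(p in undis A) (x \notin dis G p.1 p.2).
  rewrite (sum_bool_card [in undis A] (fun p => x \notin dis G p.1 p.2)); apply: eq_card => p.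
  rewrite /undis [LHS]inE [RHS]inE inE -andbA; congr (_ && _).
  by rewrite -!setI_eq0 setIUl setU_eq0 [_ :&: _ == set0]setI_eq0 disjoints1 inE andbC.
under eq_bigr do rewrite e.
rewrite exchange_big /= mulnC -sum_nat_const; apply: leq_sum => p; rewrite inE => /andP [pp _].
rewrite (sum_bool_card predT) /= (_ : [set _ | _] = ~: dis G p.1 p.2); last first.
  by apply/setP => x; rewrite !inE.
by rewrite [#|~: _|]cardsCs setCK leq_sub2l // dP.
Qed.

End Undistinguished.

Import Order.TTheory GRing.Theory Num.Theory.
Local Open Scope ring_scope.

(** * Fixity on subsets and multisets *)

(* Invariant subsets correspond to b = 1 and invariant multisets of weight m to b = m. *)
Section GeneratingFunction.
Variables (R : realFieldType) (T : finType) (g : {perm T}) (b : nat).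

Definition inv_funs m : {set {ffun T -> 'I_b.+1}} :=
  [set k : {ffun T -> 'I_b.+1} | [forall t, k (g t) == k t] && (\sum_t k t == m)%N].

Lemma inv_fun_porbit (k : {ffun T -> 'I_b.+1}) t u : [forall t, k (g t) == k t] ->
  u \in porbit g t -> k u = k t.
Proof.
move=> /forallP H /porbitP [i ->]; elim: i => [|i IH]; first by rewrite expg0 perm1.
by rewrite expgSr permM (eqP (H _)).
Qed.

(** An invariant function is a choice of a value j on each cycle c, contributing |c| j to the
    weight. The product is thus a generating function with nonnegative terms and bounds each of its
    terms at x >= 0. *)
Lemma inv_funs_weight_le m (x : R) : 0 <= x ->
  #|inv_funs m|%:R * x ^+ m <= \prod_(c in porbits g) \sum_(j < b.+1) x ^+ (#|c| * j).
Proof.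
move=> x0; rewrite (big_distr_big_dep (@ord0 b)) /=.
(* The value [ord0] off the cycles is the default prescribed by the expansion of the product. *)
pose phi (k : {ffun T -> 'I_b.+1}) : {ffun {set T} -> 'I_b.+1} :=
  [ffun c : {set T} => if c \in porbits g then oapp k ord0 [pick u in c] else ord0].
have phiE k t : k \in inv_funs m -> phi k (porbit g t) = k t.
  rewrite inE => /andP [kinv _]; rewrite ffunE imset_f //.
  by case: pickP => [u /(inv_fun_porbit kinv)//|/(_ t)]; rewrite /= porbit_id.
have phi_inj : {in inv_funs m &, injective phi}.
  by move=> k k' kI kI' e; apply/ffunP => t; rewrite -!phiE // e.
have weight k : k \in inv_funs m -> \prod_(c in porbits g) x ^+ (#|c| * phi k c) = x ^+ m.
  move=> kI; rewrite -expr_sum; congr (_ ^+ _).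
  have := kI; rewrite inE => /andP [_ /eqP <-].
  rewrite (partition_big (porbit g) [in porbits g]) => [|t _]; last exact: imset_f.
  apply: eq_bigr => c /imsetP [t _ ->].
  rewrite (eq_bigl [in porbit g t]) => [|u]; last by rewrite eq_porbit_mem.
  rewrite (eq_bigr (fun=> phi k (porbit g t) : nat)) ?sum_nat_const // => u ut.
  rewrite phiE //; have := kI; rewrite inE => /andP [kinv _].
  by rewrite (inv_fun_porbit kinv ut).
have -> : #|inv_funs m|%:R * x ^+ m =
    \sum_(f in phi @: inv_funs m) \prod_(c in porbits g) x ^+ (#|c| * f c).
  rewrite big_imset //= (eq_bigr (fun=> x ^+ m)) ?sumr_const ?mulr_natl //.
rewrite [leRHS](bigID [in phi @: inv_funs m]) /=.
rewrite [X in _ <= X + _](eq_bigl [in phi @: inv_funs m]) => [|f].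
  by rewrite lerDl sumr_ge0 // => f _; rewrite prodr_ge0 // => c _; rewrite exprn_ge0.
rewrite andbC andb_idr // => /imsetP [k _ ->]; apply/pfamilyP; split=> [|c //].
by apply/supportP => c cP; rewrite ffunE (negPf cP).
Qed.

(** A cycle of length l > 1 is charged B for each of its l points, a fixed point is charged A. *)
Lemma cycle_prod_le (phi : nat -> R) (A B : R) : 0 <= A -> 0 <= B -> (forall l, 0 <= phi l) ->
  phi 1%N <= A -> (forall l, (1 < l)%N -> phi l <= B ^+ l) ->
  \prod_(c in porbits g) phi #|c| <= A ^+ (#|T| - #|supp g|) * B ^+ #|supp g|.
Proof.
move=> A0 B0 phi0 phi1 phiB.
have -> : A ^+ (#|T| - #|supp g|) * B ^+ #|supp g| = \prod_t (if t \in supp g then B else A).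
  rewrite (bigID [in supp g]) /= mulrC; congr (_ * _).
    by rewrite (eq_bigr (fun=> B)) ?prodr_const // => t /= ->.
  rewrite (eq_bigr (fun=> A)) ?prodr_const => [|t /negPf -> //]; congr (_ ^+ _).
  by rewrite -(cardC (supp g)) addKn; apply: eq_card.
rewrite (partition_big (porbit g) [in porbits g]) => [|t _]; last exact: imset_f.
apply: ler_prod => c /imsetP [t _ ->]; rewrite phi0 /=.
rewrite (eq_bigl [in porbit g t]) => [|u]; last by rewrite eq_porbit_mem.
have gfix u : u \in porbit g t -> (u \in supp g) = (1 < #|porbit g t|)%N.
  move=> ut; have := perm_fix_dvd g 1 u; rewrite expg1 inE => ->.
  have -> : porbit g u = porbit g t by apply/eqP; rewrite eq_porbit_mem.
  have : (0 < #|porbit g t|)%N by apply/card_gt0P; exists t; apply: porbit_id.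
  by rewrite dvdn1; case: #|_| => [|[|]].
have [l1|l1] := ltnP 1 #|porbit g t|.
  by rewrite (eq_bigr (fun=> B)) ?prodr_const ?phiB // => u /gfix ->; rewrite l1.
have l1' : #|porbit g t| = 1%N.
  by apply/eqP; rewrite eqn_leq l1; apply/card_gt0P; exists t; apply: porbit_id.
by rewrite (eq_bigr (fun=> A)) ?prodr_const ?l1' ?expr1 // => u /gfix ->; rewrite l1'.
Qed.

End GeneratingFunction.

(** * Contribution of one cycle, and the mode of a binomial distribution *)

Section CycleFactors.
Variable R : realFieldType.
Implicit Types x B : R.

(** B is the 2-norm of (1, x), which dominates the l-norm. *)
Lemma subset_factor x B l : 0 <= x -> 0 <= B -> B ^+ 2 = 1 + x ^+ 2 -> (1 < l)%N ->
  \sum_(j < 2) x ^+ (l * j) <= B ^+ l.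
Proof.
move=> x0 B0 B2 l1; rewrite !big_ord_recl big_ord0 /= muln0 muln1 expr0 addr0.
have xl k : 0 <= x ^+ k by rewrite exprn_ge0.
rewrite -ler_sqr ?nnegrE; [|by rewrite addr_ge0|exact: exprn_ge0].
rewrite -exprM mulnC exprM B2.
case: l l1 => [//|[//|l]] _; elim: l => [|l IH]; first by rewrite expr2.
rewrite exprS [leRHS]exprS.
have := ler_wpM2l (addr_ge0 ler01 (xl 2%N)) IH; apply: le_trans.
set y := x ^+ l.+2; have y0 : 0 <= y by apply: xl.
rewrite -subr_ge0; have -> : (1 + x ^+ 2) * (1 + y) ^+ 2 - (1 + x * y) ^+ 2 =
   (x - y) ^+ 2 + 2 * y * (1 + x ^+ 2) by ring.
apply: addr_ge0; first exact: sqr_ge0.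
by apply: mulr_ge0; [apply: mulr_ge0 | apply: addr_ge0].
Qed.

Lemma geometric_le x k l : 0 <= x -> x < 1 -> (0 < l)%N ->
  \sum_(j < k) x ^+ (l * j) <= (1 - x ^+ l)^-1.
Proof.
move=> x0 x1 l0; have xl1 : x ^+ l < 1 by rewrite exprn_ilt1 // -lt0n.
have xl0 : 0 <= x ^+ l by rewrite exprn_ge0.
rewrite (eq_bigr (fun j : 'I_k => (x ^+ l) ^+ j)) => [|j _]; last by rewrite exprM.
rewrite -[leRHS]mul1r ler_pdivlMr ?subr_gt0 //.
by have := subrX1 (x ^+ l) k; have := exprn_ge0 k xl0; lra.
Qed.

(** After summing the full geometric series this is (1 - x^2)^l <= (1 - x^l)^2, by induction on
    l. *)
Lemma multiset_factor x B l k : 0 <= x -> x < 1 -> 0 <= B -> B ^+ 2 = (1 - x ^+ 2)^-1 ->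
  (1 < l)%N ->
  \sum_(j < k) x ^+ (l * j) <= B ^+ l.
Proof.
move=> x0 x1 B0 B2 l1; apply: le_trans (geometric_le _ x0 x1 (ltnW l1)) _.
have xlt j : (0 < j)%N -> 0 < 1 - x ^+ j by move=> j0; rewrite subr_gt0 exprn_ilt1 // -lt0n.
have xl := xlt l (ltnW l1); have xl2 := xlt 2%N isT.
rewrite -ler_sqr ?nnegrE; [|by rewrite invr_ge0 ltW|exact: exprn_ge0].
rewrite -exprM mulnC exprM B2 !exprVn lef_pV2 ?posrE; [|exact: exprn_gt0|exact: exprn_gt0].
case: l l1 {xl} => [//|[//|l]] _; elim: l => [|l IH]; first by rewrite expr2.
rewrite exprS; have := ler_wpM2l (ltW (xlt 2%N isT)) IH; move/le_trans; apply.
have p := xlt l.+2 isT; have p' := xlt l.+3 isT.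
apply: (@le_trans _ _ (1 * (1 - x ^+ l.+2) ^+ 2)).
  by rewrite ler_wpM2r ?sqr_ge0 // gerBl exprn_ge0.
rewrite mul1r ler_sqr ?nnegrE ?(ltW p) ?(ltW p') // lerD2l lerN2 [x ^+ l.+3]exprS.
by rewrite ler_piMl ?exprn_ge0 // ltW.
Qed.

(** Of the N + 1 binomial probabilities, which sum to 1, the one at m is the largest. This takes the
    place of Stirling's formula. *)
Lemma binomial_mode (N m : nat) (p : R) : (m <= N)%N -> 0 < p -> p < 1 ->
  m%:R <= N.+1%:R * p -> N.+1%:R * p <= m.+1%:R ->
  1 <= N.+1%:R * ('C(N, m)%:R * p ^+ m * (1 - p) ^+ (N - m)).
Proof.
move=> mN p0 p1 lo hi; pose t k : R := 'C(N, k)%:R * p ^+ k * (1 - p) ^+ (N - k).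
have q0 : 0 < 1 - p by lra.
have step k : (k < N)%N -> t k.+1 * (k.+1%:R * (1 - p)) = t k * ((N - k)%:R * p).
  move=> kN; rewrite /t (_ : (N - k = (N - k.+1).+1)%N); last by lia.
  rewrite !exprS; have := mul_bin_left N k => /(congr1 (fun z => z%:R : R)); rewrite !natrM => e.
  rewrite (_ : (N - k = (N - k.+1).+1)%N) in e; last by lia.
  transitivity (k.+1%:R * 'C(N, k.+1)%:R * (p * p ^+ k * (1 - p) ^+ (N - k.+1) * (1 - p)));
    first by ring.
  by rewrite e; ring.
have t0 k : 0 <= t k by rewrite /t !mulr_ge0 ?exprn_ge0 // ltW.
have NE : (N.+1%:R = N%:R + 1 :> R) by rewrite -natr1.
have kE k : (k.+1%:R = k%:R + 1 :> R) by rewrite -natr1.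
have up k : (k < m)%N -> t k <= t k.+1.
  move=> km; have kN : (k < N)%N by lia.
  have c0 : 0 < k.+1%:R * (1 - p) by rewrite mulr_gt0.
  rewrite -(ler_pM2r c0) step // ler_wpM2l //.
  have : k.+1%:R <= m%:R :> R by rewrite ler_nat.
  by rewrite natrB ?(ltnW kN) // kE; move: lo; rewrite NE; lra.
have down k : (m <= k)%N -> (k < N)%N -> t k.+1 <= t k.
  move=> mk kN; have c0 : 0 < k.+1%:R * (1 - p) by rewrite mulr_gt0.
  rewrite -(ler_pM2r c0) step // ler_wpM2l //.
  have : m.+1%:R <= k.+1%:R :> R by rewrite ler_nat.
  by rewrite natrB ?(ltnW kN) // !kE; move: hi; rewrite NE kE; lra.
have tm k : (k <= N)%N -> t k <= t m.
  move=> kN; have [km|mk] := leqP k m.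
    have : t (m - (m - k))%N <= t m; last by rewrite subKn.
    elim: (m - k)%N => [|i IH]; first by rewrite subn0.
    have [im|im] := ltnP i m; last by rewrite (_ : (m - i.+1 = m - i)%N) //; lia.
    apply: le_trans IH; have := up (m - i.+1)%N; rewrite (_ : ((m - i.+1).+1 = m - i)%N); last
      by lia.
    by apply; lia.
  elim: k kN mk => [//|k IH] kN mk.
  have [mk'|mk'] := ltnP m k; last first.
    have e : m = k by lia.
    by rewrite e down // e.
  apply: (@le_trans _ _ (t k)); first by apply: down => //; apply: ltnW.
  by apply: IH => //; apply: ltnW.
have := exprDn (1 - p) p N; rewrite subrK expr1n => e.
have -> : N.+1%:R * ('C(N, m)%:R * p ^+ m * (1 - p) ^+ (N - m)) = \sum_(i < N.+1) t m.
  by rewrite sumr_const card_ord mulr_natl.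
rewrite e.
apply: ler_sum => i _.
have -> : (1 - p) ^+ (N - i) * p ^+ i *+ 'C(N, i) = t i by rewrite /t -mulr_natl; ring.
by apply: tm; rewrite -ltnS.
Qed.

End CycleFactors.

Lemma card_fix_subsets (T : finType) (g : {perm T}) m :
  (#|[set A in msubsets T m | ('P^*)%act A g == A]| <= #|inv_funs g 1 m|)%N.
Proof.
pose ind (A : {set T}) : {ffun T -> 'I_2} := [ffun t => if t \in A then ord_max else ord0].
have ind_inj : injective ind.
  move=> A B /ffunP e; apply/setP => t; have := e t; rewrite !ffunE.
  by move/(congr1 val); case: ifP => _; case: ifP.
rewrite -(card_imset _ ind_inj); apply: subset_leq_card; apply/subsetP => _ /imsetP [A AI ->].
move: AI; rewrite !inE => /andP [/eqP cA /eqP gA]; apply/andP; split.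
  apply/forallP => t; rewrite !ffunE.
  by rewrite -{1}gA /= /setact -[g t]/(aperm t g) (mem_imset _ _ (@act_inj _ _ _ 'P g)).
rewrite (eq_bigr (fun t => (t \in A) : nat)) => [|t _]; last by rewrite ffunE; case: (t \in A).
by rewrite (sum_bool_card predT) /= -cA; apply/eqP; apply: eq_card => t; rewrite inE.
Qed.

Lemma card_fix_multisets (T : finType) (g : {perm T}) m :
  (#|[set k in multisets T m | multiset_action T m k g == k]| <= #|inv_funs g m m|)%N.
Proof.
apply: subset_leq_card; apply/subsetP => k; rewrite !inE => /andP [-> /eqP /ffunP e].
rewrite andbT; apply/forallP => t; have := e (g t); rewrite ffunE permK => ->; exact: eqxx.
Qed.

Lemma card_multisets (T : finType) m : (0 < #|T|)%N -> ('C(#|T| + m - 1, m) <= #|multisets T m|)%N.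
Proof.
move=> n0; have nE : #|T| = #|T|.-1.+1 by rewrite prednK.
have := card_ord_partitions #|T|.-1 m.
rewrite (_ : 'C(#|T|.-1 + m, #|T|.-1) = 'C(#|T| + m - 1, m))%N; last first.
  by rewrite -[RHS]bin_sub; [congr 'C(_, _)%N; lia | lia].
move=> <-.
pose phi (t : #|T|.-1.+1.-tuple 'I_m.+1) : {ffun T -> 'I_m.+1} :=
  [ffun x => tnth t (cast_ord nE (enum_rank x))].
have rk (i : 'I_(#|T|.-1.+1)) : exists x : T, cast_ord nE (enum_rank x) = i.
  by exists (enum_val (cast_ord (esym nE) i)); rewrite enum_valK cast_ordKV.
have phi_inj : injective phi.
  move=> t u /ffunP e; apply: eq_from_tnth => i; have [x <-] := rk i.
  by have := e x; rewrite !ffunE.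
rewrite -(card_imset _ phi_inj); apply: subset_leq_card; apply/subsetP => _ /imsetP [t tI ->].
move: tI; rewrite !inE => /eqP tm; apply/eqP; rewrite -[RHS]tm big_tuple.
rewrite [RHS](reindex (fun x : T => cast_ord nE (enum_rank x))) /=.
  by apply: eq_bigr => x _; rewrite ffunE.
exists (fun i => enum_val (cast_ord (esym nE) i)) => x _; rewrite ?cast_ordK ?enum_rankK //.
by rewrite enum_valK cast_ordKV.
Qed.

Section FixRatio.
Variable R : rcfType.

(** A fixed point costs A and a moved point xi A, while the last hypothesis says that A^n / x^m, the
    bound for the identity, is at most M times S. *)
Lemma fix_ratio_bound (T : finType) (g : {perm T}) (b m : nat) (x A xi M S : R) :
  0 < x -> 0 < A -> 0 <= xi ->
  \sum_(j < b.+1) x ^+ (1 * j) <= A ->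
  (forall l, (1 < l)%N -> \sum_(j < b.+1) x ^+ (l * j) <= (xi * A) ^+ l) ->
  A ^+ #|T| <= M * S * x ^+ m ->
  #|inv_funs g b m|%:R <= M * xi ^+ #|supp g| * S.
Proof.
move=> x0 A0 xi0 h1 hl hM.
have := inv_funs_weight_le g b m (ltW x0).
have phi0 l : 0 <= \sum_(j < b.+1) x ^+ (l * j).
  by apply: sumr_ge0 => j _; rewrite exprn_ge0 // ltW.
move/le_trans => /(_ _ (cycle_prod_le g (ltW A0) (mulr_ge0 xi0 (ltW A0)) phi0 h1 hl)).
rewrite exprMn mulrCA -exprD subnK ?max_card // => h.
rewrite -(ler_pM2r (exprn_gt0 m x0)); apply: le_trans h _.
have := ler_wpM2l (exprn_ge0 #|supp g| xi0) hM; move/le_trans; apply.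
by rewrite le_eqVlt; apply/orP; left; apply/eqP; ring.
Qed.

(** x = m / (n - m) minimises (1 + x)^n / x^m, and there sqrt (1 + x^2) / (1 + x) is exactly xi. The
    loss n + 1 comes from the binomial mode at p = m / n. *)
Lemma fix_ratio_subsets (T : finType) (g : {perm T}) m (xi : R) : (0 < m < #|T|)%N ->
  0 <= xi -> xi ^+ 2 = (m%:R ^+ 2 + (#|T|%:R - m%:R) ^+ 2) / #|T|%:R ^+ 2 ->
  #|[set A in msubsets T m | ('P^*)%act A g == A]|%:R <=
    (#|T|%:R + 1) * xi ^+ #|supp g| * #|msubsets T m|%:R.
Proof.
move=> /andP [m0 mn] xi0 xi2; apply: le_trans (_ : #|inv_funs g 1 m|%:R <= _).
  by rewrite ler_nat card_fix_subsets.
set n := #|T| in mn xi2 *.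
have n0 : 0 < n%:R :> R by rewrite ltr0n; lia.
have mR : 0 < m%:R :> R by rewrite ltr0n.
have nm : m%:R < n%:R :> R by rewrite ltr_nat.
pose x : R := m%:R / (n%:R - m%:R); pose A : R := n%:R / (n%:R - m%:R).
have x0 : 0 < x by rewrite divr_gt0 // subr_gt0.
have A0 : 0 < A by rewrite divr_gt0 // subr_gt0.
have AE : A = 1 + x by rewrite /A /x; field; lra.
apply: (@fix_ratio_bound T g 1 m x A) => //.
- by rewrite !big_ord_recl big_ord0 /= muln0 muln1 expr0 addr0 expr1 AE.
- move=> l l1; apply: subset_factor => //; [exact: ltW | by rewrite mulr_ge0 // ltW |].
  by rewrite exprMn xi2 /A /x; field; lra.
have p0 : 0 < m%:R / n%:R :> R by rewrite divr_gt0.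
have p1 : m%:R / n%:R < 1 :> R by rewrite ltr_pdivrMr // mul1r.
have := binomial_mode (ltnW mn) p0 p1.
rewrite -!natr1 => /(_ _ _) h.
have {h} : 1 <= (n%:R + 1) * ('C(n, m)%:R * (m%:R / n%:R) ^+ m * (1 - m%:R / n%:R) ^+ (n - m)) :> R.
  apply: h.
    rewrite mulrDl mul1r mulrCA divff ?gt_eqF // mulr1; lra.
  by rewrite mulrDl mul1r mulrCA divff ?gt_eqF // mulr1; lra.
rewrite card_draws -/n => h.
have An : A ^+ n = A ^+ m * A ^+ (n - m) by rewrite -exprD subnKC // ltnW.
have := ler_wpM2l (exprn_ge0 n (ltW A0)) h; rewrite mulr1 => /le_trans; apply.
have e1 : m%:R / n%:R = x / A by rewrite /x /A; field; lra.
have e2 : 1 - m%:R / n%:R = A^-1 by rewrite /A; field; lra.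
rewrite e2 e1 An [(x / A) ^+ m]exprMn !exprVn.
have Am : A ^+ m != 0 by rewrite expf_neq0 // gt_eqF.
have Anm : A ^+ (n - m) != 0 by rewrite expf_neq0 // gt_eqF.
by rewrite le_eqVlt; apply/orP; left; apply/eqP; field; rewrite Am Anm.
Qed.

(** x = m / (n + m) minimises (1 - x)^(-n) / x^m, and there sqrt ((1 - x) / (1 + x)) is exactly xi.
    The binomial mode is used with n + m - 1 trials and n - 1 failures, so besides n + m another
    factor (n + m) / n is lost. *)
Lemma fix_ratio_multisets (T : finType) (g : {perm T}) m (xi : R) : (0 < m)%N -> (0 < #|T|)%N ->
  0 <= xi -> xi ^+ 2 = #|T|%:R / (#|T|%:R + 2 * m%:R) ->
  #|[set k in multisets T m | multiset_action T m k g == k]|%:R <=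
    ((#|T|%:R + m%:R) ^+ 2 / #|T|%:R) * xi ^+ #|supp g| * #|multisets T m|%:R.
Proof.
move=> m0 n0 xi0 xi2; apply: le_trans (_ : #|inv_funs g m m|%:R <= _).
  by rewrite ler_nat card_fix_multisets.
set n := #|T| in n0 xi2 *.
have nR : 0 < n%:R :> R by rewrite ltr0n.
have mR : 0 < m%:R :> R by rewrite ltr0n.
pose x : R := m%:R / (n%:R + m%:R); pose A : R := (n%:R + m%:R) / n%:R.
have x0 : 0 < x by rewrite divr_gt0 // addr_gt0.
have x1 : x < 1 by rewrite ltr_pdivrMr ?addr_gt0 // mul1r ltrDr.
have A0 : 0 < A by rewrite divr_gt0 // addr_gt0.
have AE : A = (1 - x)^-1 by rewrite /A /x; field; lra.
apply: (@fix_ratio_bound T g m m x A) => //.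
- by rewrite AE -[x in leRHS]expr1; apply: geometric_le => //; rewrite ltW.
- move=> l l1; apply: multiset_factor => //; [exact: ltW | by rewrite mulr_ge0 // ltW |].
  rewrite exprMn xi2 /A /x; field.
  have nm2 : 0 < (n%:R + m%:R) ^+ 2 - m%:R ^+ 2 :> R
    by rewrite subr_sqr addrK mulr_gt0 // !addr_gt0.
  by apply/and4P; split; apply: lt0r_neq0 => //; lra.
have := @binomial_mode R (n + m - 1) m x _ x0 x1.
have NE : (n + m - 1).+1%:R = n%:R + m%:R :> R by rewrite -natrD; congr (_%:R); lia.
rewrite NE => h.
have {h} : 1 <= (n%:R + m%:R) * ('C(n + m - 1, m)%:R * x ^+ m * (1 - x) ^+ (n + m - 1 - m)) :> R.
  have e : (n%:R + m%:R) * x = m%:R by rewrite /x mulrC divfK // gt_eqF // addr_gt0.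
  by apply: h; [lia | rewrite e | rewrite e ler_nat].
rewrite (_ : (n + m - 1 - m = n.-1)%N); last by lia.
have -> : 1 - x = A^-1 by rewrite AE invrK.
have cS : 'C(n + m - 1, m)%:R <= #|multisets T m|%:R :> R by rewrite ler_nat card_multisets.
move=> h; rewrite -/n.
have := ler_wpM2l (exprn_ge0 n (ltW A0)) h; rewrite mulr1 => /le_trans; apply.
have An : A ^+ n = A * A ^+ n.-1 by rewrite -exprS prednK.
have Am : A ^+ n.-1 != 0 by rewrite expf_neq0 // gt_eqF.
rewrite An exprVn.
have -> : A * A ^+ n.-1 * ((n%:R + m%:R) * ('C(n + m - 1, m)%:R * x ^+ m * (A ^+ n.-1)^-1)) =
  A * (n%:R + m%:R) * x ^+ m * 'C(n + m - 1, m)%:R by field.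
have -> : (n%:R + m%:R) ^+ 2 / n%:R * #|multisets T m|%:R * x ^+ m =
  A * (n%:R + m%:R) * x ^+ m * #|multisets T m|%:R by rewrite /A; field; lra.
apply: ler_wpM2l => //; apply: mulr_ge0; last by rewrite exprn_ge0 // ltW.
by apply: mulr_ge0; [exact: ltW | rewrite addr_ge0].
Qed.

End FixRatio.

(** * Average stabilizer size *)

Section AverageStabilizer.
Variables (R : realType) (gT : finGroupType) (sT : finType) (to : {action gT &-> sT}).
Variables (G : {group gT}) (S : {set sT}).
Hypotheses (actS : [acts G, on S | to]) (S0 : (0 < #|S|)%N).

Let avg : R := avg_stab to R G S.

Let S_gt0 : 0 < #|S|%:R :> R. Proof. by rewrite ltr0n. Qed.

Lemma sum_stab : \sum_(s in S) #|'C_G[s | to]|%:R = #|S|%:R * avg.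
Proof. by rewrite /avg /avg_stab mulrA divff ?mul1r // gt_eqF // S_gt0. Qed.

Lemma sum_stab_fix :
  (\sum_(s in S) #|'C_G[s | to]| = \sum_(g in G) #|[set s in S | to s g == s]|)%N.
Proof.
transitivity (\sum_(s in S) \sum_(g in G) (to s g == s))%N.
  apply: eq_bigr => s _; rewrite -sum1_card [RHS]big_mkcond [LHS]big_mkcond /=; apply: eq_bigr =>
    g _.
  by rewrite in_setI (sameP astab1P eqP); case: (g \in G) => //=; case: eqP.
rewrite exchange_big /=; apply: eq_bigr => g _.
rewrite -sum1_card [RHS]big_mkcond [LHS]big_mkcond /=; apply: eq_bigr => s _.
by rewrite inE; case: (s \in S) => //=; case: eqP.
Qed.

Lemma avg_stab_le (rho : R) : 0 <= rho ->
  (forall g, g \in G -> g != 1%g -> #|[set s in S | to s g == s]|%:R <= rho * #|S|%:R) ->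
  avg - 1 <= #|G|%:R * rho.
Proof.
move=> rho0 H; have Sp := S_gt0;
  rewrite -(ler_pM2l Sp) mulrBr mulr1 -sum_stab -natr_sum sum_stab_fix.
rewrite (bigD1 1%g) ?group1 //= natrD.
have -> : [set s in S | to s 1%g == s] = S.
  by apply/setP => s; rewrite inE act1 eqxx andbT.
rewrite addrAC subrr add0r natr_sum.
apply: le_trans (_ : \sum_(g in G | g != 1%g) rho * #|S|%:R <= _).
  by apply: ler_sum => g /andP [Gg g1]; apply: H.
rewrite sumr_const -[_ *+ _]mulr_natl mulrA [leRHS]mulrC.
apply: ler_wpM2r; first exact: ltW.
apply: ler_wpM2r => //; rewrite ler_nat.
by apply: subset_leq_card; apply/subsetP => g /andP[].
Qed.

Lemma exists_orbit_ge_avg : exists2 O, O \in orbits to G S & #|G|%:R <= #|O|%:R * avg.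
Proof.
have [s Ss sle] : exists2 s, s \in S & #|'C_G[s | to]|%:R <= avg.
  apply/exists_inP; apply: contraT; rewrite negb_exists_in => /forall_inP no.
  have : \sum_(s in S) avg < \sum_(s in S) #|'C_G[s | to]|%:R.
    have /card_gt0P [s0 S0'] := S0.
    rewrite (bigD1 s0) //= [X in _ < X](bigD1 s0) //=; apply: ltr_leD.
      by rewrite ltNge no.
    by apply: ler_sum => s /andP [Ss _]; rewrite ltW // ltNge no.
  by rewrite sum_stab sumr_const mulr_natl ltxx.
exists (orbit to G s); first exact: imset_f.
by rewrite -(card_orbit_stab to G s) natrM ler_wpM2l.
Qed.

Lemma stab_orbit O s : O \in orbits to G S -> s \in O -> (#|O| * #|'C_G[s | to]| = #|G|)%N.
Proof.
case/imsetP => s0 _ -> sO; rewrite -(card_orbit_stab to G s).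
by have /orbit_eqP -> := sO.
Qed.

(** Each orbit contributes |G| to the sum of the stabilizer sizes. On a nonregular orbit |Stab| <= 2
    (|Stab| - 1), so there are at most 2 |S| (avg - 1) / |G| such orbits, out of |S| avg / |G|. *)
Lemma regular_ratio_ge : 1 - 2 * (avg - 1) <= regular_ratio to R G S.
Proof.
pose P := orbits to G S; pose Q := [set O in P | #|O| == #|G|].
have part : partition P S := orbit_partition actS.
have G0 : 0 < #|G|%:R :> R by rewrite ltr0n cardG_gt0.
have orb_pos O : O \in P -> exists2 s, s \in O & s \in S.
  by case/imsetP => s Ss ->; exists s => //; apply: orbit_refl.
have PG : #|P|%:R * #|G|%:R = #|S|%:R * avg.
  rewrite -sum_stab (set_partition_big _ part) /= mulr_natl -sumr_const; apply: eq_bigr => O PO.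
  have [s0 s0O _] := orb_pos O PO.
  rewrite (eq_bigr (fun=> #|'C_G[s0 | to]|%:R)) => [|s sO].
    by rewrite sumr_const -(stab_orbit PO s0O) natrM mulr_natl.
  have O0 : (0 < #|O|)%N by apply/card_gt0P; exists s0.
  congr (_%:R); apply/eqP; rewrite -(eqn_pmul2l O0); apply/eqP.
  by rewrite !(stab_orbit PO).
have avg1 : 1 <= avg.
  rewrite -(ler_pM2l S_gt0) mulr1 -sum_stab -sumr_const; apply: ler_sum => s _.
  by rewrite ler1n cardG_gt0.
have P0 : 0 < #|P|%:R :> R.
  by rewrite -(pmulr_lgt0 _ G0) PG mulr_gt0 ?S_gt0 //; apply: lt_le_trans avg1.
have QE : regular_ratio to R G S = #|Q|%:R / #|P|%:R by [].
have nonreg : #|P :\: Q|%:R * #|G|%:R <= 2 * (#|S|%:R * (avg - 1)).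
  have -> : #|S|%:R * (avg - 1) = \sum_(s in S) (#|'C_G[s | to]|%:R - 1).
    by rewrite mulrBr mulr1 -sum_stab sumrB sumr_const.
  rewrite (set_partition_big _ part) /=.
  rewrite (bigID [in Q]) /= mulrDr -[leLHS]add0r lerD //.
    rewrite mulr_ge0 // sumr_ge0 // => O _; rewrite sumr_ge0 // => s _.
    by rewrite subr_ge0 ler1n cardG_gt0.
  rewrite (eq_bigl [in P :\: Q]) => [|O]; last by rewrite [RHS]in_setD andbC.
  rewrite mulr_natl -sumr_const mulr_sumr; apply: ler_sum => O; rewrite in_setD => /andP [nQ PO].
  have nreg s : s \in O -> (2 <= #|'C_G[s | to]|)%N.
    move=> sO; have := stab_orbit PO sO; have := cardG_gt0 'C_G[s | to].
    case: #|_ :&: _| => [//|[|//]] _; rewrite muln1 => e.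
    by move: nQ; rewrite inE PO e eqxx.
  have -> : #|G|%:R = \sum_(s in O) #|'C_G[s | to]|%:R :> R.
    have [s0 s0O _] := orb_pos O PO.
    rewrite (eq_bigr (fun=> #|'C_G[s0 | to]|%:R)) => [|s sO].
      by rewrite sumr_const -(stab_orbit PO s0O) natrM mulr_natl.
    have O0 : (0 < #|O|)%N by apply/card_gt0P; exists s0.
    congr (_%:R); apply/eqP; rewrite -(eqn_pmul2l O0); apply/eqP.
    by rewrite !(stab_orbit PO).
  rewrite mulr_sumr; apply: ler_sum => s sO; have := nreg s sO; rewrite -(ler_nat R).
  by lra.
have PQ : #|P|%:R = #|Q|%:R + #|P :\: Q|%:R :> R.
  have PQ : P :&: Q = Q by apply/setIidPr/subsetP => O; rewrite inE => /andP[].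
  by rewrite -natrD -(cardsID Q P) PQ.
rewrite QE ler_pdivlMr // mulrBl mul1r [X in X - _]PQ lerBlDr lerD2l.
rewrite -(ler_pM2r G0); apply: le_trans nonreg _.
rewrite -mulrA PG.
have : #|S|%:R * (avg - 1) * 1 <= #|S|%:R * (avg - 1) * avg.
  by rewrite ler_wpM2l // mulr_ge0 ?subr_ge0.
lra.
Qed.

End AverageStabilizer.

From mathcomp Require Import all_classical all_reals all_analysis.
Import numFieldNormedType.Exports.
Local Open Scope classical_set_scope.
Local Open Scope ring_scope.

(** * Order of uniprimitive groups *)

Section LogSums.
Variable R : realType.
Implicit Types (x y a b : R).

Lemma ln1D_tangent a b : 0 <= a -> 0 <= b -> ln (1 + a) <= ln (1 + b) + (a - b) / (1 + b).
Proof.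
move=> a0 b0; have b1 : 0 < 1 + b by lra.
have -> : 1 + a = (1 + b) * (1 + (a - b) / (1 + b)) by field; lra.
have c0 : -1 < (a - b) / (1 + b) by rewrite ltr_pdivlMr //; lra.
by rewrite lnM ?posrE; [rewrite lerD2l le_ln1Dx | lra | lra].
Qed.

(** Jensen's inequality via the tangent at b; an upper bound b for the mean suffices. *)
Lemma sum_ln1D (T : finType) (a : T -> R) b : (forall z, 0 <= a z) -> 0 <= b ->
  \sum_x a x <= #|T|%:R * b -> \sum_x ln (1 + a x) <= #|T|%:R * ln (1 + b).
Proof.
move=> a0 b0 H; apply: (@le_trans _ _ (\sum_x (ln (1 + b) + (a x - b) / (1 + b)))).
  by apply: ler_sum => x _; apply: ln1D_tangent.
rewrite big_split /= -mulr_suml sumrB !sumr_const !mulr_natl -[leRHS]addr0 lerD2l.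
rewrite ler_pdivrMr ?mul0r ?subr_le0; last lra.
by rewrite mulr_natl in H.
Qed.

Section ExpSums.
Let f y : R := ln (1 + expR y).

(** ln (1 + t) <= t leaves a geometric series, and 1 / (1 - exp (- lam)) <= 1 + 1 / lam. *)
Lemma sum_ln_neg (lam : R) K y : 0 < lam -> y <= 0 ->
  \sum_(i < K) f (y - lam * i%:R) <= expR y * (1 + lam^-1).
Proof.
move=> lam0; have C0 : 0 < 1 + lam^-1 by rewrite addr_gt0 ?invr_gt0.
elim: K y => [|K IH] y y0; first by rewrite big_ord0 mulr_ge0 ?expR_ge0 // ltW.
rewrite big_ord_recl /= mulr0 subr0.
have -> : \sum_(i < K) f (y - lam * (bump 0 i)%:R) = \sum_(i < K) f (y - lam - lam * i%:R).
  by apply: eq_bigr => i _; congr f; rewrite /bump /= natrD; ring.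
have e0 := expR_gt0 y.
apply: le_trans (lerD (le_ln1Dx _) (IH (y - lam) _)) _; [lra | lra |].
rewrite expRB -[X in X + _]mulr1 -mulrA -mulrDr ler_wpM2l ?expR_ge0 //.
have := expR_ge1Dx lam => e.
have : (expR lam)^-1 <= (1 + lam)^-1 by rewrite lef_pV2 ?posrE ?expR_gt0 //; lra.
move/(ler_wpM2r (ltW C0)) => h; apply: le_trans (lerD (lexx 1) h) _.
have -> : (1 + lam)^-1 * (1 + lam^-1) = lam^-1 by field; lra.
by [].
Qed.

(** The right-hand side grows by exactly y + 1 >= f y from y - lam to y. Its leading term is the
    integral of the positive part of y - lam i over i >= 0. *)
Lemma sum_ln_pos (lam : R) K y : 0 < lam -> lam <= 1 -> 0 <= y -> \sum_(i < K) f (y - lam * i%:R) <=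
  y ^+ 2 / (2 * lam) + (lam^-1 + 1 / 2) * y + (2 + lam^-1).
Proof.
move=> lam0 lam1; have l0 : 0 < lam^-1 by rewrite invr_gt0.
have l1 : 1 <= lam^-1 by rewrite invr_ge1 // unitfE gt_eqF.
have pos z : 0 <= z -> 0 <= z ^+ 2 / (2 * lam) by move=> z0;
  rewrite divr_ge0 ?exprn_ge0 // mulr_ge0 //; lra.
elim: K y => [|K IH] y y0.
  rewrite big_ord0; have := pos y y0; have : 0 <= (lam^-1 + 1 / 2) * y by rewrite mulr_ge0 //; lra.
  lra.
rewrite big_ord_recl /= mulr0 subr0.
have -> : \sum_(i < K) f (y - lam * (bump 0 i)%:R) = \sum_(i < K) f (y - lam - lam * i%:R).
  by apply: eq_bigr => i _; congr f; rewrite /bump /= natrD; ring.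
have fy : f y <= y + 1.
  rewrite /f; have -> : 1 + expR y = expR y * (1 + expR (- y)).
    by rewrite mulrDr mulr1 expRxMexpNx_1 addrC.
  have e0 := expR_gt0 (- y).
  have e1 : 0 < 1 + expR (- y) by lra.
  rewrite lnM ?posrE ?expR_gt0 // expRK.
  rewrite lerD2l; apply: le_trans (le_ln1Dx _) _; first lra.
  by rewrite expR_le1; lra.
have [yl|yl] := leP lam y.
  apply: le_trans (lerD fy (IH (y - lam) _)) _; first lra.
  rewrite -subr_ge0.
  have -> : y ^+ 2 / (2 * lam) + (lam^-1 + 1 / 2) * y + (2 + lam^-1) -
    (y + 1 + ((y - lam) ^+ 2 / (2 * lam) + (lam^-1 + 1 / 2) * (y - lam) + (2 + lam^-1))) = 0.
    by field; lra.
  by [].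
apply: le_trans (lerD fy (@sum_ln_neg lam K (y - lam) lam0 _)) _; first lra.
have h : expR (y - lam) * (1 + lam^-1) <= 1 * (1 + lam^-1).
  by rewrite ler_wpM2r ?expR_le1; lra.
have := pos y y0; have : 1 * y <= (lam^-1 + 1 / 2) * y by rewrite ler_wpM2r //; lra.
lra.
Qed.

End ExpSums.
End LogSums.

Section UniprimitiveOrder.
Variables (R : realType) (T : finType) (G : {group {perm T}}) (d : nat).
Hypotheses (n0 : (0 < #|T|)%N) (dn : (d <= #|T|)%N).
Hypothesis dP : forall a b, a != b -> (d <= #|dis G a b|)%N.
Let n : R := #|T|%:R.
Let q : R := (#|T| - d)%:R / n.
Let L : R := ln #|G|%:R.

Let n_gt0 : 0 < n. Proof. by rewrite /n ltr0n. Qed.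
Let q_ge0 : 0 <= q. Proof. by rewrite divr_ge0. Qed.

(* The next base point is averaged over T: the orbit sizes are controlled by Jensen's inequality,
   and the number of undistinguished pairs is multiplied by at most q on average. *)
Lemma ln_stab_le K (A : {set T}) (U : R := #|undis G A|%:R) :
  ln #|'C_G(A | 'P)|%:R <= \sum_(i < K) ln (1 + U * q ^+ i / n) + U * q ^+ K * L.
Proof.
rewrite {}/U; elim: K A => [|K IH] A.
  rewrite big_ord0 add0r expr0 mulr1.
  have L0 : 0 <= L by rewrite ln_ge0 // ler1n cardG_gt0.
  have [U0|U0] := posnP #|undis G A|.
    have -> : #|'C_G(A | 'P)| = 1%N; last by rewrite ln1 U0 mul0r.
    have -> : 'C_G(A | 'P) = 1%g; last by rewrite cards1.
    apply: orbit_pairs0; apply/eqP; rewrite -cards_eq0 -leqn0 -U0.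
    by apply: subset_leq_card; apply: orbit_pairs_sub_undis.
  apply: (@le_trans _ _ L); last by rewrite -[leLHS]mul1r ler_wpM2r // ler1n.
  by rewrite ler_ln ?posrE ?ltr0n ?cardG_gt0 // ler_nat subset_leq_card // subsetIl.
rewrite -(ler_pM2l n_gt0).
set H := ('C_G(A | 'P))%G.
have -> : n * ln #|H|%:R = \sum_x (ln #|orbit 'P H x|%:R + ln #|'C_G(x |: A | 'P)|%:R).
  rewrite (eq_bigr (fun=> ln #|H|%:R)) ?sumr_const ?mulr_natl // => x _.
  rewrite -lnM ?posrE ?ltr0n ?cardG_gt0 //; last first.
    by apply/card_gt0P; exists x; apply: orbit_refl.
  by rewrite -natrM stab_setU1 card_orbit_stab.
rewrite big_split /= big_ord_recl /= expr0 mulr1.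
have S1 : \sum_x ln #|orbit 'P H x|%:R <= n * ln (1 + #|undis G A|%:R / n) :> R.
  pose a x : R := #|orbit 'P H x|%:R - 1.
  have -> : \sum_x ln #|orbit 'P H x|%:R = \sum_x ln (1 + a x).
    by apply: eq_bigr => x _; rewrite /a addrC subrK.
  apply: sum_ln1D => [x||]; last 1 first.
  - rewrite sumrB sumr_const -natr_sum mulrC divfK ?gt_eqF // lerBlDl -natrD ler_nat.
    exact: sum_card_orbit.
  - rewrite subr_ge0 ler1n; apply/card_gt0P; exists x; exact: orbit_refl.
  - by rewrite divr_ge0 // ltW.
have SU : \sum_x #|undis G (x |: A)|%:R <= n * (q * #|undis G A|%:R) :> R.
  rewrite /q mulrA [n * _]mulrC divfK ?gt_eqF // -natr_sum -natrM ler_nat.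
  exact: sum_card_undis.
have S2 : \sum_x ln #|'C_G(x |: A | 'P)|%:R <=
    n * (\sum_(i < K) ln (1 + #|undis G A|%:R * q ^+ (bump 0 i) / n) + #|undis G A|%:R * q ^+ K.+1 * L).
  apply: le_trans (ler_sum _ (fun x _ => IH (x |: A))) _.
  rewrite big_split /= mulrDr lerD //.
    rewrite exchange_big mulr_sumr /=; apply: ler_sum => i _.
    apply: sum_ln1D => [x||].
    - by rewrite divr_ge0 ?mulr_ge0 ?exprn_ge0 // ltW.
    - by rewrite divr_ge0 ?mulr_ge0 ?exprn_ge0 // ltW.
    rewrite -!mulr_suml /bump /= add1n exprS.
    have c0 : 0 <= q ^+ i / n by rewrite divr_ge0 ?exprn_ge0 // ltW.
    by have := ler_wpM2r c0 SU; rewrite -/n !mulrA => /le_trans; apply;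
      rewrite mulrAC -!mulrA mulrCA !mulrA; lra.
  rewrite -!mulr_suml exprS.
  have L0 : 0 <= L by rewrite ln_ge0 // ler1n cardG_gt0.
  have c0 : 0 <= q ^+ K * L by rewrite mulr_ge0 ?exprn_ge0.
  by have := ler_wpM2r c0 SU; lra.
by have := lerD S1 S2; lra.
Qed.

End UniprimitiveOrder.

Section UniprimitiveBounds.
Variables (R : realType) (T : finType) (G : {group {perm T}}).
Hypotheses (primG : [primitive G, on [set: T]%SET | 'P])
  (ntrG : ~~ [transitive^2 G, on [set: T]%SET | 'P]).

Lemma sqrt_le_dis (s : R) a b : 0 <= s -> s ^+ 2 = #|T|%:R -> a != b -> s <= 2 * #|dis G a b|%:R.
Proof.
move=> s0 sn ab; have := card_dis_ge primG ntrG ab; rewrite -(ler_nat R) -sn natrM natrX => h.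
rewrite -ler_sqr ?nnegrE ?mulr_ge0 //; by apply: le_trans h _; rewrite le_eqVlt; apply/orP; left;
  apply/eqP; ring.
Qed.

Lemma min_degree_uniprimitive (s : R) h : 0 <= s -> s ^+ 2 = #|T|%:R ->
  h \in G -> h != 1%g -> s <= 2 * #|supp h|%:R.
Proof.
move=> s0 sn Gh h1; have [a ha] : exists a, a != h a.
  apply/existsP; apply: contraT => /existsPn no; case/negP: h1; apply/eqP/permP => a.
  by rewrite perm1; have := no a; rewrite negbK => /eqP.
apply: le_trans (sqrt_le_dis s0 sn ha) _.
by rewrite ler_pM2l // ler_nat subset_leq_card // dis_sub_supp.
Qed.

(** [ln_stab_le] is applied to the empty set. As q <= 1 - 1 / (2 s) <= exp (- lam) and there are at
    most n^2 pairs, the i-th term is at most ln (1 + n exp (- lam i)), and the leading term is (ln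
    n)^2 / (2 lam) = s (ln n)^2. *)
Lemma ln_order_uniprimitive (s : R) : (1 < #|T|)%N -> 1 <= s -> s ^+ 2 = #|T|%:R ->
  ln #|G|%:R <= s * ln #|T|%:R ^+ 2 + (2 * s + 1 / 2) * ln #|T|%:R + (2 + 2 * s).
Proof.
move=> n1 s1 sn; set l := ln #|T|%:R.
have [d dn [dP ds]] : exists2 d, (d <= #|T|)%N & (forall a b, a != b ->
  (d <= #|dis G a b|)%N) /\ s <= 2 * d%:R.
  have /card_gt1P [a [b [_ _ ab]]] : (1 < #|[set: T]%SET|)%N by rewrite cardsT.
  pose p := [arg min_(p < (a, b) | p.1 != p.2) #|dis G p.1 p.2|]%N.
  have [pn pmin] : p.1 != p.2 /\ forall c d, c != d -> (#|dis G p.1 p.2| <= #|dis G c d|)%N.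
    rewrite /p; case: arg_minnP => //= q qn H; split=> // c d cd; exact: (H (c, d)).
  exists #|dis G p.1 p.2|; first exact: max_card.
  by split=> //; apply: sqrt_le_dis => //; lra.
have n0 : (0 < #|T|)%N by lia.
have nR : 0 < #|T|%:R :> R by rewrite ltr0n.
pose lam := (2 * s)^-1; pose q : R := (#|T| - d)%:R / #|T|%:R.
have lam0 : 0 < lam by rewrite invr_gt0; lra.
have lam1 : lam <= 1 by rewrite invf_le1; lra.
have q0 : 0 <= q by rewrite divr_ge0.
have qe : q <= expR (- lam).
  apply: le_trans (expR_ge1Dx _); rewrite /q natrB // mulrBl divff ?gt_eqF //.
  rewrite lerD2l lerN2 /lam -sn ler_pdivlMr ?exprn_gt0 //; last lra.
  have -> : (2 * s)^-1 * s ^+ 2 = s / 2 by field; lra.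
  by rewrite ler_pdivrMr // mulrC.
pose B := s * l ^+ 2 + (2 * s + 1 / 2) * l + (2 + 2 * s).
have l0 : 0 <= l by rewrite ln_ge0 // ler1n.
pose L : R := ln #|G|%:R.
have L0 : 0 <= L by rewrite ln_ge0 // ler1n cardG_gt0.
have U2 : #|undis G (finset.set0 : {set T})|%:R <= #|T|%:R ^+ 2 :> R.
  by rewrite -natrX ler_nat (leq_trans (max_card _)) // card_prod.
have LK K : L <= B + #|T|%:R ^+ 2 * q ^+ K * L.
  have := @ln_stab_le R T G d n0 dP K finset.set0.
  rewrite -/q -/L (_ : 'C_G(finset.set0 | 'P) = G); last first.
    by apply/finset.setIidPl/fintype.subsetP => g _; apply/astabP => x; rewrite inE.
  move/le_trans; apply; apply: lerD; last first.
    by rewrite ler_wpM2r // ler_wpM2r // exprn_ge0.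
  have := @sum_ln_pos R lam K l lam0 lam1 l0.
  have -> : l ^+ 2 / (2 * lam) + (lam^-1 + 1 / 2) * l + (2 + lam^-1) = B.
    by rewrite /lam /B; field; lra.
  apply: le_trans; apply: ler_sum => i _.
  rewrite ler_ln ?posrE; [|by rewrite ltr_pwDl // divr_ge0 ?mulr_ge0 ?exprn_ge0 |
    by rewrite addr_gt0 ?expR_gt0].
  rewrite lerD2l expRB lnK ?posrE //.
  have qi : q ^+ i <= (expR (lam * i%:R))^-1.
    rewrite -expRN -mulNr expRM_natr lerXn2r ?nnegrE ?expR_ge0 //.
  rewrite ler_pdivrMr // -mulrA [_^-1 * _]mulrC mulrA -expr2.
  by apply: ler_pM => //; rewrite exprn_ge0.
rewrite leNgt; apply/negP => BL.
have BL' : 0 < L - B by rewrite subr_gt0.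
have L1 : 0 < L.
  apply: lt_le_trans BL' _; rewrite gerBl /B.
  by rewrite !addr_ge0 ?mulr_ge0 ?exprn_ge0 //; lra.
(* K is taken so large that the remainder falls below L - B. *)
pose C := #|T|%:R ^+ 2 * L / (L - B).
have [K KC] : exists K : nat, C < 1 + lam * K%:R.
  exists (Num.truncn (C / lam)).+1.
  have := truncnS_gt (C / lam); rewrite ltr_pdivrMr // mulrC => h.
  by apply: lt_le_trans h _; rewrite lerDr.
have := LK K; apply/negP; rewrite -ltNge -ltrBrDl.
have qK : q ^+ K <= (expR (lam * K%:R))^-1.
  by rewrite -expRN -mulNr expRM_natr lerXn2r ?nnegrE ?expR_ge0.
have eK : C < expR (lam * K%:R) by apply: lt_le_trans KC (expR_ge1Dx _).
rewrite mulrAC; apply: (@le_lt_trans _ _ (#|T|%:R ^+ 2 * L * (expR (lam * K%:R))^-1)).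
  by rewrite ler_wpM2l // mulr_ge0 // exprn_ge0.
rewrite ltr_pdivrMr ?expR_gt0 //.
by move: eK; rewrite /C ltr_pdivrMr // [expR _ * _]mulrC.
Qed.

End UniprimitiveBounds.

(** * Asymptotics *)

Section Asymptotics.
Variable R : realType.
Implicit Types (delta eps lam Lam s l L : R).

Lemma expR_ge_pow (x : R) k : 0 <= x -> x ^+ k.+1 / (k.+1)`!%:R <= expR x.
Proof. by move=> x0; apply: le_trans (expR_ge1Dxn k x0); rewrite lerDr. Qed.

Lemma ln2_le1 : ln 2 <= 1 :> R.
Proof. by apply: le_trans (_ : ln (1 + 1) <= _); [rewrite le_eqVlt eqxx | apply: le_ln1Dx; lra].
  Qed.

(* Here l, s, L and lam stand for ln n, sqrt n, ln |G| and |ln xi|. *)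
Lemma large_orbit_asymptotics delta eps Lam C : 0 < delta < 1 / 8 -> 0 < eps -> 0 <= Lam ->
  0 <= C ->
  exists l0 : R, forall lam s l L, l0 <= l -> s = expR (l / 2) -> eps <= lam <= Lam ->
    l <= L -> L <= s * l ^+ 2 + (2 * s + 1 / 2) * l + (2 + 2 * s) ->
    (1 / 8 - delta) * lam / (ln L) ^+ 2 * L <= L - ln 2 /\
    (1 / 8 - delta) * lam / (ln L) ^+ 2 * L <= lam * (s / 2) - (C + l) - ln 2.
Proof.
move=> /andP [d0 d1] e0 Lam0 C0.
have [k kE] : exists k, k = delta * eps by exists (delta * eps).
have k0 : 0 < k by rewrite kE mulr_gt0.
exists (2 + expR (1 + Lam) + 8 / delta + 8 * (C + 2) / k) => lam s l L ll sE /andP [le lL] lL1 lL2.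
have p1 := expR_gt0 (1 + Lam).
have p2 : 0 < 8 / delta by rewrite divr_gt0.
have p3 : 0 < 8 * (C + 2) / k by rewrite divr_gt0 // mulr_gt0 //; lra.
have l2 : 2 <= l by lra.
have lE : expR (1 + Lam) <= l by lra.
have ld : 8 / delta <= l by lra.
have lk : 8 * (C + 2) / k <= l by lra.
have lam0 : 0 < lam by lra.
clear ll p2 p3.
have lnl : 1 + Lam <= ln l by rewrite -[leLHS]expRK ler_ln ?posrE //; lra.
have lnL : ln l <= ln L by rewrite ler_ln ?posrE //; lra.
have lnL1 : 1 + Lam <= ln L by lra.
have lnL2 : 1 + Lam <= ln L ^+ 2.
  have : (1 + Lam) * 1 <= ln L * ln L by apply: ler_pM => //; lra.
  by rewrite mulr1 expr2.
have lnL20 : 0 < ln L ^+ 2 by lra.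
clear lE lnl lnL p1.
have L0 : 0 < L by lra.
have s1 : l ^+ 2 / 8 <= s.
  rewrite sE; have h : 0 <= l / 2 by lra.
  by have := expR_ge_pow 1 h; rewrite (_ : 2`! = 2)%N // expr_div_n; lra.
have s0 : 1 <= s by have := expR_ge1Dx (l / 2); rewrite -sE; lra.
have big : C + l + 1 <= k * s.
  have h1 : l * (C + 2) <= k * (l ^+ 2 / 8).
    move: lk; rewrite ler_pdivrMr // => lk.
    by have := ler_wpM2l (_ : 0 <= l) lk => /(_ ltac:(lra)); lra.
  have h2 : k * (l ^+ 2 / 8) <= k * s by rewrite ler_wpM2l // ltW.
  have h3 : 2 * (C + 2) <= l * (C + 2) by rewrite ler_wpM2r //; lra.
  have h4 : l * 1 + 1 * C <= l * (C + 1) by nra.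
  by lra.
have ln2 := ln2_le1.
clear lk.
have c0 : 0 <= 1 / 8 - delta by lra.
split.
  apply: (@le_trans _ _ (1 / 8 * L)); last by lra.
  apply: ler_wpM2r; first exact: ltW.
  rewrite ler_pdivrMr //.
  apply: (@le_trans _ _ (1 / 8 * lam)); first by rewrite ler_wpM2r //; lra.
  by rewrite ler_wpM2l //; lra.
have kl : k <= delta * lam by rewrite kE ler_wpM2l // ltW.
have kls : k * s <= delta * lam * s by rewrite ler_wpM2r //; lra.
have {big} {}kls : C + l + 1 <= delta * lam * s by lra.
clear kl k0 kE k.
have ls0 : 0 < lam * s by rewrite mulr_gt0 //; lra.
(* For L <= s, the bound (ln L)^2 >= 1 is enough and gives lam s / 8. Otherwise (ln L)^2 >= l^2 / 4
   turns 1/8 into 1/2. *)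
have [Ls|sL] := leP L s.
  apply: (@le_trans _ _ (1 / 8 * lam * s)); last first.
    have : delta * (lam * s) <= 1 / 8 * (lam * s) by rewrite ler_wpM2r //; lra.
    by move: kls; lra.
  apply: ler_pM => //; [by rewrite divr_ge0 ?mulr_ge0 //; lra | lra |].
  rewrite ler_pdivrMr //.
  apply: (@le_trans _ _ (1 / 8 * lam)); first by rewrite ler_wpM2r //; lra.
  by rewrite -[leLHS]mulr1 ler_wpM2l ?mulr_ge0 //; lra.
have lnLs : l / 2 <= ln L by rewrite -[l / 2]expRK -sE ler_ln ?posrE //; lra.
have lnLs2 : l ^+ 2 / 4 <= ln L ^+ 2.
  have : (l / 2) ^+ 2 <= ln L ^+ 2 by rewrite ler_sqr ?nnegrE; lra.
  by rewrite expr_div_n; lra.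
have Lb : L <= s * l ^+ 2 * (1 + 4 * delta).
  apply: le_trans lL2 _.
  have h1 : 8 <= delta * l by move: ld; rewrite ler_pdivrMr // mulrC.
  have h2 : 8 * l <= delta * l ^+ 2 by rewrite expr2 mulrA ler_wpM2r //; lra.
  have h3 : s * (8 * l) <= s * (delta * l ^+ 2) by rewrite ler_wpM2l //; lra.
  have h4 : s * 2 <= s * l by rewrite ler_wpM2l //; lra.
  have h5 : 1 * l <= s * l by rewrite ler_wpM2r //; lra.
  by lra.
have key : (1 / 8 - delta) * lam / ln L ^+ 2 * L <= (1 / 8 - delta) * lam * (4 * s * (1 + 4 * delta)).
  rewrite -mulrA; apply: ler_wpM2l; first by rewrite mulr_ge0 //; lra.
  rewrite mulrC ler_pdivrMr //; apply: le_trans Lb _.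
  have : 4 * s * (1 + 4 * delta) * (l ^+ 2 / 4) <= 4 * s * (1 + 4 * delta) * ln L ^+ 2.
    by rewrite ler_wpM2l // mulr_ge0 //; lra.
  by lra.
apply: le_trans key _.
(* As 4 (1/8 - delta) (1 + 4 delta) = 1/2 - 2 delta - 16 delta^2, a margin 2 delta lam s remains for
   C + l and ln 2. *)
have : (1 / 8 - delta) * lam * (4 * s * (1 + 4 * delta)) <= lam * s * (1 / 2 - 2 * delta).
  rewrite (_ : (1 / 8 - delta) * lam * (4 * s * (1 + 4 * delta)) = lam * s * ((1 / 8 - delta) * 4 * (1 + 4 * delta))); last by ring.
  by rewrite ler_pM2l //; have := sqr_ge0 delta; lra.
by move: kls; lra.
Qed.

(** With t = n^(1/5), sqrt n = t^2 exp (l / 10), and the cubic term of exp (l / 10) beats l^2. *)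
Lemma regular_orbit_asymptotics delta eps C c : 0 < delta -> 0 < eps -> 0 <= C -> 0 < c ->
  exists l0 : R, forall lam s l L, l0 <= l -> s = expR (l / 2) -> eps <= lam ->
    L <= c * (expR (l / 5) ^+ 2 * l ^+ 2) -> L + (C + l) <= lam * (delta * s).
Proof.
move=> d0 e0 C0 c0; have [k kE] : exists k, k = delta * eps by exists (delta * eps).
have k0 : 0 < k by rewrite kE mulr_gt0.
exists (1 + 16 * (C + 2) / k + 10 * 10 * 10 * 12 * c / k) => lam s l L ll sE le LL.
have p3 : 0 < 16 * (C + 2) / k.
  by apply: divr_gt0 => //; apply: mulr_gt0; [rewrite ltr0n | lra].
have p4 : 0 < 10 * 10 * 10 * 12 * c / k.
  by apply: divr_gt0 => //; apply: mulr_gt0; [lra | exact: c0].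
have l1 : 1 <= l by lra.
have lk : 16 * (C + 2) / k <= l by lra.
have lk' : 10 * 10 * 10 * 12 * c / k <= l by lra.
clear ll p3 p4.
have s1 : l ^+ 2 / 8 <= s.
  rewrite sE; have h : 0 <= l / 2 by lra.
  by have := expR_ge_pow 1 h; rewrite (_ : 2`! = 2)%N // expr_div_n; lra.
have s0 : 0 < s by rewrite sE expR_gt0.
have big1 : C + l <= k * s / 2.
  have h1 : l * (C + 2) <= k * (l ^+ 2 / 8) / 2.
    move: lk; rewrite ler_pdivrMr // => lk.
    by have := ler_wpM2l (_ : 0 <= l) lk => /(_ ltac:(lra)); lra.
  have h2 : k * (l ^+ 2 / 8) <= k * s by rewrite ler_wpM2l // ltW.
  have h4 : l * 1 + 1 * C <= l * (C + 1) by nra.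
  by lra.
have big2 : L <= k * s / 2.
  apply: le_trans LL _; set t := expR (l / 5).
  have t0 : 0 < t by apply: expR_gt0.
  have sE' : s = t ^+ 2 * expR (l / 10).
    by rewrite sE /t -expRM_natl -expRD; congr expR; field.
  have h : 0 <= l / 10 by lra.
  have h3 := expR_ge_pow 2 h; rewrite (_ : 3`! = 6)%N // in h3.
  have h4 : c * l ^+ 2 <= k * ((l / 10) ^+ 3 / 6) / 2.
    move: lk'; rewrite ler_pdivrMr // => lk'.
    have := ler_wpM2l (_ : 0 <= l ^+ 2) lk' => /(_ (sqr_ge0 _)); rewrite expr_div_n; lra.
  have h5 : k * ((l / 10) ^+ 3 / 6) <= k * expR (l / 10) by rewrite ler_wpM2l // ltW.
  have h6 : c * l ^+ 2 <= k * expR (l / 10) / 2 by lra.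
  have := ler_wpM2l (ltW (exprn_gt0 2 t0)) h6; rewrite sE'; lra.
have kl : k * s <= lam * (delta * s).
  by rewrite kE mulrA [lam * delta]mulrC ler_wpM2r ?(ltW s0) // ler_wpM2l // ltW.
by lra.
Qed.

Lemma exp_sqrt_asymptotics eps : 0 < eps ->
  exists s0 : R, forall s, s0 <= s -> 2 * expR (- (eps * s)) <= (s ^+ 2 + 1)^-1.
Proof.
move=> e0; exists (1 + 24 / eps ^+ 3) => s ss.
have e3 : 0 < eps ^+ 3 by rewrite exprn_gt0.
have p : 0 < 24 / eps ^+ 3 by rewrite divr_gt0.
have s1 : 1 <= s by lra.
have es : 24 <= s * eps ^+ 3 by rewrite -ler_pdivrMr //; lra.
have es0 : 0 <= eps * s by rewrite mulr_ge0 //; lra.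
have := expR_ge_pow 2 es0; rewrite (_ : 3`! = 6)%N // exprMn => h.
have s2 : 0 < s ^+ 2 + 1 by have := sqr_ge0 s; lra.
rewrite expRN ler_pdivrMr ?expR_gt0 // mulrC ler_pdivlMr // mulrC.
have h1 : 24 * s ^+ 2 <= s * eps ^+ 3 * s ^+ 2 by rewrite ler_wpM2r ?sqr_ge0.
have h2 : 1 <= s ^+ 2 by rewrite -[leLHS](expr1n _ 2) ler_sqr ?nnegrE; lra.
have : 4 * s ^+ 2 <= expR (eps * s).
  by apply: le_trans h; rewrite ler_pdivlMr //; move: h1; rewrite [s ^+ 3]exprS; lra.
lra.
Qed.

End Asymptotics.

Section TwoTransitiveOrder.
Variables (R : realType) (T : finType) (G : {group {perm T}}).
Hypotheses (trG : [transitive^2 G, on [set: T]%SET | 'P]) (nA : ~~ ('Alt_T \subset G)).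

(** The l' <= 40 n^(1/5) of [order_ttrans_cover] and a K slightly above 6 l' ln n give (1 - 1 / (3
    l'))^K n^2 < 1, since 1 - y <= exp (- y). Hence ln |G| <= K l' ln n. *)
Lemma ln_order_ttrans (l : R) : l = ln #|T|%:R -> 5 * (200 * 200) <= l ->
  ln #|G|%:R <= (6 * 40 ^+ 2 + 40) * (expR (l / 5) ^+ 2 * l ^+ 2).
Proof.
move=> lE l1; have l96 : 96 <= l by lra.
have n0 : (0 < #|T|)%N.
  by rewrite lt0n; apply: contraTneq l96 => n0; rewrite lE n0 ln0 // -ltNge; lra.
set n := #|T| in lE n0 *.
have nR : 0 < n%:R :> R by rewrite ltr0n.
have nE : n%:R = expR l by rewrite lE lnK.
pose s := expR (l / 2); have sn : s ^+ 2 = n%:R by rewrite nE /s -expRM_natl; congr expR; field.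
have s48 : 48 <= s by have := expR_ge1Dx (l / 2); rewrite -/s; lra.
have mindeg h : h \in G -> h != 1%g -> (n <= 4 * #|supp h|)%N.
  move=> Gh h1; have := min_degree_ttrans trG nA sn s48 Gh h1.
  rewrite -/n => H; rewrite -(ler_nat R) natrM.
  have : 8 * s <= n%:R by rewrite -sn expr2 ler_pM2r; lra.
  by lra.
pose t := expR (l / 5); have t5 : t ^+ 5 = n%:R by rewrite nE /t -expRM_natl; congr expR; field.
have tl : l / 5 <= t by have := expR_ge1Dx (l / 5); rewrite -/t; lra.
have zex : exists z, (z ^ 5 <= n)%N by exists 0%N.
have zbd z : (z ^ 5 <= n -> z <= n)%N.
  by apply: leq_trans; case: z => // z; rewrite -{1}(expn1 z.+1) leq_pexp2l.
have [z zn zmax] := ex_maxnP zex zbd.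
have zn' : (n < z.+1 ^ 5)%N.
  by rewrite ltnNge; apply/negP => /zmax; rewrite ltnn.
have z4 : (200 * 200 <= z)%N.
  apply: zmax; rewrite -(ler_nat R) natrX natrM -t5; apply: lerXn2r; rewrite ?nnegrE; [lra
    | exact: ltW (expR_gt0 _) |].
  by apply: le_trans tl; lra.
have zt : z%:R <= t.
  have : z%:R ^+ 5 <= t ^+ 5 by rewrite t5 -natrX ler_nat.
  by rewrite ler_pXn2r ?nnegrE // ltW // expR_gt0.
have [l' /andP [l'0 l'z] H] := order_ttrans_cover trG mindeg z4 (introT andP (conj zn zn')).
clear z4 zmax l1 zn zn' zex zbd mindeg.
have l'R : 0 < l'%:R :> R by rewrite ltr0n.
have l't : l'%:R <= 40 * t.
  have : l'%:R <= 40 * z%:R :> R by rewrite -natrM ler_nat.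
  by lra.
have l0 : 0 < l by lra.
have p6 : 0 < 6 * l'%:R * l by rewrite !mulr_gt0.
have [K K1 K2] : exists2 K : nat, 6 * l'%:R * l < K%:R & K%:R <= 6 * l'%:R * l + 1.
  exists (Num.truncn (6 * l'%:R * l)).+1; first exact: truncnS_gt.
  by rewrite -natr1 lerD2r truncn_le // ltW.
have HK : ((3 * l' - 1) ^ K * (n * n) < (3 * l') ^ K)%N.
  have q0 : 0 < 3 * l'%:R :> R by rewrite mulr_gt0.
  have l3 : (3 * l' - 1)%:R = 3 * l'%:R - 1 :> R by rewrite natrB ?muln_gt0 // natrM.
  rewrite -(ltr_nat R) natrM [X in X * _]natrX [X in _ < X]natrX [(n * n)%:R]natrM [(3 * l')%:R]natrM l3.
  have h1 : 3 * l'%:R - 1 <= 3 * l'%:R * expR (- (3 * l'%:R)^-1) :> R.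
    have := ler_wpM2l (ltW q0) (expR_ge1Dx (- (3 * l'%:R)^-1)).
    have -> : 3 * l'%:R * (1 + - (3 * l'%:R)^-1) = 3 * l'%:R - 1 :> R by field; rewrite gt_eqF.
    by [].
  have h0 : 0 <= 3 * l'%:R - 1 :> R.
    have : 1 <= l'%:R :> R by rewrite ler1n.
    by lra.
  have h2 : (3 * l'%:R - 1) ^+ K <= (3 * l'%:R) ^+ K * expR (- (K%:R / (3 * l'%:R))) :> R.
    rewrite -mulrN expRM_natl -exprMn; apply: lerXn2r => //; rewrite nnegrE //.
  apply: (@le_lt_trans _ _ ((3 * l'%:R) ^+ K * expR (- (K%:R / (3 * l'%:R))) * (n%:R * n%:R))).
    by rewrite ler_wpM2r // mulr_ge0.
  rewrite -mulrA -[ltRHS]mulr1 ltr_pM2l ?exprn_gt0 // nE -!expRD expR_lt1.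
  rewrite addrC subr_lt0 ltr_pdivlMr //; move: K1; lra.
have := H K HK; rewrite -/n => GK.
have LK : ln #|G|%:R <= K%:R * (l'%:R * l).
  apply: (@le_trans _ _ (ln ((n ^ l') ^ K)%:R)).
    by rewrite ler_ln ?posrE ?ltr0n ?cardG_gt0 ?expn_gt0 ?n0 // ler_nat.
  by rewrite !natrX !lnXn ?exprn_gt0 // -lE !mulr_natl.
apply: le_trans LK _.
have l'l : l'%:R * l <= 40 * t * l by rewrite ler_wpM2r // ltW.
have l'l0 : 0 <= l'%:R * l by rewrite mulr_ge0 // ltW.
apply: (@le_trans _ _ ((6 * (40 * t * l) + 1) * (40 * t * l))).
  by apply: ler_pM => //; apply: le_trans K2 _; rewrite lerD2r -mulrA ler_wpM2l.
have tl1 : 1 <= t * l.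
  have : 1 * 1 <= t * l by apply: ler_pM => //; lra.
  by rewrite mulr1.
have : 1 * (t * l) <= (t * l) * (t * l) by rewrite ler_wpM2r //; lra.
by rewrite -/t; lra.
Qed.

End TwoTransitiveOrder.

(** * Conclusion *)

Lemma nat_above_expR (R : realType) (l0 : R) :
  exists n0 : nat, forall n : nat, (n0 < n)%N -> l0 <= ln n%:R.
Proof.
exists (Num.truncn (expR l0)).+1 => n nn.
have nR : expR l0 < n%:R.
  by apply: lt_trans (truncnS_gt _) _; rewrite ltr_nat.
have n0 : 0 < n%:R :> R by apply: lt_trans (expR_gt0 _) nR.
by rewrite -[leLHS]expRK ler_ln ?posrE ?expR_gt0 // ltW.
Qed.

Lemma expR_half_sqr (R : realType) (n : nat) : (0 < n)%N ->
  expR (ln n%:R / 2) ^+ 2 = n%:R :> R.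
Proof.
move=> n0; rewrite -expRM_natl mulrC divfK ?gt_eqF // lnK // posrE ltr0n //.
Qed.

Section Conclusion.
Variables (R : realType) (eps : R).
Hypothesis heps : 0 < eps < 1 / 2.

(* The factor (1 + 1 / eps)^2 n bounds both n + 1 and (n + m)^2 / n in the range of m considered. *)
Definition geometric_fixity (T sT : finType) (to : {action {perm T} &-> sT}) (S : {set sT}) (xi : R) :=
  forall g : {perm T}, #|finset (fun s => (s \in S) && (to s g == s))|%:R <=
    (1 + eps^-1) ^+ 2 * #|T|%:R * xi ^+ #|supp g| * #|S|%:R.

(** Bounds in terms of eps alone keep the thresholds independent of m; the lower one is ln (1 - eps)
    <= - eps. *)
Lemma ln_xi_bounds (xi : R) : 0 < xi -> eps / 2 <= xi ^+ 2 -> xi ^+ 2 <= 1 - eps ->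
  eps / 2 <= - ln xi <= - ln (eps / 2).
Proof.
have /andP[e0 e1] := heps; move=> x0 lo hi.
have x2 : 0 < xi ^+ 2 by rewrite exprn_gt0.
have l2 : ln (xi ^+ 2) = 2 * ln xi by rewrite lnXn // mulr_natl.
have h1 : ln (xi ^+ 2) <= - eps.
  apply: (@le_trans _ _ (ln (1 + - eps))); last by apply: le_ln1Dx; lra.
  by rewrite ler_ln ?posrE //; lra.
have h2 : ln (eps / 2) <= ln (xi ^+ 2) by rewrite ler_ln ?posrE //; lra.
by apply/andP; split; lra.
Qed.

Let C : R := ln ((1 + eps^-1) ^+ 2).

Let C_ge0 : 0 <= C.
Proof.
have /andP[e0 e1] := heps; apply: ln_ge0; have p : 0 < eps^-1 by rewrite invr_gt0.
by rewrite -[leLHS](expr1n _ 2) lerXn2r ?nnegrE //; lra.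
Qed.

Let expR_C (n : nat) : (0 < n)%N -> expR (C + ln n%:R) = (1 + eps^-1) ^+ 2 * n%:R.
Proof.
have /andP[e0 e1] := heps; move=> n0; have p : 0 < eps^-1 by rewrite invr_gt0.
by rewrite expRD /C !lnK ?posrE ?ltr0n // exprn_gt0 //; lra.
Qed.

Lemma xi_pow (xi : R) k : 0 < xi -> xi ^+ k = expR (- (- ln xi * k%:R)).
Proof. by move=> x0; rewrite mulNr opprK mulrC expRM_natl lnK. Qed.

Lemma avg_stab_le_fixity (T sT : finType) (to : {action {perm T} &-> sT}) (G : {group {perm T}})
    (S : {set sT}) (xi mu : R) :
  (0 < #|T|)%N -> [acts G, on S | to] -> (0 < #|S|)%N -> 0 < xi -> 0 < - ln xi ->
  geometric_fixity to S xi ->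
  (forall g, g \in G -> g != 1%g -> mu <= #|supp g|%:R) ->
  avg_stab to R G S - 1 <= #|G|%:R * expR (C + ln #|T|%:R - (- ln xi * mu)).
Proof.
move=> n0 actS S0 x0 lx fixS hmu.
apply: avg_stab_le => // g Gg g1.
apply: le_trans (fixS g) _.
rewrite expRB expR_C // -expRN ler_wpM2r // ler_wpM2l //.
  by rewrite mulr_ge0 // sqr_ge0.
by rewrite xi_pow // ler_expR lerN2 ler_pM2l // hmu.
Qed.

Lemma uniprimitive_large_orbit (delta : R) : 0 < delta < 1 / 8 ->
  exists n0 : nat, forall (T : finType) (G : {group {perm T}}), (n0 < #|T|)%N -> uniprimitive G ->
  forall (sT : finType) (to : {action {perm T} &-> sT}) (S : {set sT}) (xi : R),
  [acts G, on S | to] -> (0 < #|S|)%N -> 0 < xi -> eps / 2 <= xi ^+ 2 -> xi ^+ 2 <= 1 - eps ->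
  geometric_fixity to S xi -> has_large_orbit to G S delta xi.
Proof.
have /andP[e0 e1] := heps; move=> dd.
have Lam0 : 0 <= - ln (eps / 2) by rewrite oppr_ge0 ln_le0 //; lra.
have e20 : 0 < eps / 2 by lra.
have [l0 Hl0] := large_orbit_asymptotics dd e20 Lam0 C_ge0.
have [n0 Hn0] := nat_above_expR (2 + l0 + `|l0|).
exists n0.+2 => T G nT /andP [primG ntrG] sT to S xi actS S0 x0 lo hi fixS.
have n1 : (1 < #|T|)%N by apply: leq_ltn_trans nT.
have nT0 : (0 < #|T|)%N by apply: ltnW.
pose l : R := ln #|T|%:R; pose s := expR (l / 2); pose lam := - ln xi.
have ll : 2 + l0 + `|l0| <= l by apply: Hn0; do 2!apply: ltnW.
have l00 : l0 <= l by have := normr_ge0 l0; lra.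
have l2 : 2 <= l by have := ler_norm (- l0); rewrite normrN; lra.
have sn : s ^+ 2 = #|T|%:R by apply: expR_half_sqr.
have s1 : 1 <= s by have := expR_ge1Dx (l / 2); rewrite -/s; lra.
have lamP := ln_xi_bounds x0 lo hi; have lam0 : 0 < lam by have /andP[h _] := lamP; rewrite /lam;
  lra.
pose L : R := ln #|G|%:R.
have G0 : 0 < #|G|%:R :> R by rewrite ltr0n cardG_gt0.
have trG : [transitive G, on [set: T]%SET | 'P] by case/andP: primG.
have lL : l <= L.
  rewrite ler_ln ?posrE ?ltr0n // ler_nat; apply: dvdn_leq; first exact: cardG_gt0.
  by have := atrans_dvd trG; rewrite cardsT.
have Lup := ln_order_uniprimitive primG ntrG n1 s1 sn.
have [E1 E2] := Hl0 lam s l L l00 erefl lamP lL Lup.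
set E := _ * L in E1 E2.
have hmu g : g \in G -> g != 1%g -> s / 2 <= #|supp g|%:R.
  move=> Gg g1; have := min_degree_uniprimitive primG ntrG (_ : 0 <= s) sn Gg g1.
  by move=> /(_ ltac:(lra)); lra.
have := avg_stab_le_fixity nT0 actS S0 x0 lam0 fixS hmu.
rewrite -/lam -/l => avgle.
have [Om POm GO] := exists_orbit_ge_avg R to G S0.
exists Om => //; rewrite /powR gt_eqF //.
have -> : (1 / 8 - delta) * `|ln xi| / ln (ln #|G|%:R) ^+ 2 * ln #|G|%:R = E.
  by rewrite /E /lam ler0_norm // -oppr_ge0 ltW.
(* Otherwise |G| <= |Om| avg < exp E (1 + |G| rho), although exp E <= |G| / 2 and rho exp E <= 1 /
   2. *)
rewrite leNgt; apply/negP => OmE.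
set rho := expR (C + l - lam * (s / 2)) in avgle.
have rho0 : 0 < rho by apply: expR_gt0.
have E1' : expR E <= #|G|%:R / 2.
  have : expR E <= expR (L - ln 2) by rewrite ler_expR.
  by rewrite expRB !lnK ?posrE.
have E2' : expR E * rho <= 1 / 2.
  have : expR E * rho <= expR (lam * (s / 2) - (C + l) - ln 2) * rho.
    by rewrite ler_pM2r // ler_expR.
  rewrite /rho -[X in _ <= X -> _]expRD.
  have -> : lam * (s / 2) - (C + l) - ln 2 + (C + l - lam * (s / 2)) = - ln 2 by ring.
  by rewrite expRN lnK ?posrE // div1r.
have eE := expR_gt0 E.
have avg1 : avg_stab to R G S <= 1 + #|G|%:R * rho by lra.
have h1 : #|Om|%:R * avg_stab to R G S <= #|Om|%:R * (1 + #|G|%:R * rho) by rewrite ler_wpM2l.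
have h2 : #|Om|%:R * (1 + #|G|%:R * rho) < expR E * (1 + #|G|%:R * rho).
  by rewrite ltr_pM2r // addr_gt0 // mulr_gt0.
have h3 : #|G|%:R * (expR E * rho) <= #|G|%:R * (1 / 2) by rewrite ler_pM2l.
move: GO h1 h2 h3 E1'; lra.
Qed.

Lemma two_transitive_mostly_regular (delta : R) : 0 < delta < 1 / 8 ->
  exists n0 : nat, forall (T : finType) (G : {group {perm T}}), (n0 < #|T|)%N -> two_transitive G ->
  G :!=: ('Sym_T)%g -> G :!=: ('Alt_T)%g ->
  forall (sT : finType) (to : {action {perm T} &-> sT}) (S : {set sT}) (xi : R),
  [acts G, on S | to] -> (0 < #|S|)%N -> 0 < xi -> eps / 2 <= xi ^+ 2 -> xi ^+ 2 <= 1 - eps ->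
  geometric_fixity to S xi -> mostly_regular to G S #|T| (@harmonic R) delta xi.
Proof.
have /andP[e0 e1] := heps; move=> /andP [d0 d1].
have e20 : 0 < eps / 2 by lra.
have [c [c0 cE]] : exists c : R, 0 < c /\ c = 6 * 40 ^+ 2 + 40.
  exists (6 * 40 ^+ 2 + 40); split=> //; apply: addr_gt0 => //; apply: mulr_gt0 => //;
    exact: exprn_gt0.
have [l0 Hl0] := regular_orbit_asymptotics d0 e20 C_ge0 c0.
have [s0 Hs0] := exp_sqrt_asymptotics e20.
have [M [ME M0]] : exists M : R, M = 5 * (200 * 200) /\ 0 <= M.
  by exists (5 * (200 * 200)); split; [by [] | lra].
have [n0 Hn0] := nat_above_expR (2 * 48 + M + `|l0| + 2 * `|s0|).
exists n0.+1 => T G nT trG nS nA sT to S xi actS S0 x0 lo hi fixS.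
have nAG : ~~ ('Alt_T \subset G).
  by apply/negP => /Alt_sub_Alt_or_Sym [] e; [case/eqP: nA | case/eqP: nS].
have nT0 : (0 < #|T|)%N by apply: leq_ltn_trans nT.
pose l : R := ln #|T|%:R; pose s := expR (l / 2); pose lam := - ln xi.
have ll : 2 * 48 + M + `|l0| + 2 * `|s0| <= l by apply: Hn0; apply: ltnW.
have a1 := ler_norm l0; have a2 := ler_norm s0; have a3 := normr_ge0 l0; have a4 := normr_ge0 s0.
have l00 : l0 <= l by lra.
have Ml : M <= l by lra.
have sl : l / 2 <= s by have := expR_ge1Dx (l / 2); rewrite -/s; lra.
have s48 : 48 <= s by lra.
have s00 : s0 <= s by lra.
clear a1 a2 a3 a4 ll sl.
have sn : s ^+ 2 = #|T|%:R by apply: expR_half_sqr.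
have lamP := ln_xi_bounds x0 lo hi.
have lamE : eps / 2 <= lam by case/andP: lamP.
have lam0 : 0 < lam by lra.
pose L : R := ln #|G|%:R.
have G0 : 0 < #|G|%:R :> R by rewrite ltr0n cardG_gt0.
have Lup : L <= c * (expR (l / 5) ^+ 2 * l ^+ 2).
  by rewrite cE; apply: ln_order_ttrans => //; rewrite -ME.
have E := Hl0 lam s l L l00 erefl lamE Lup.
have hmu g : g \in G -> g != 1%g -> #|T|%:R / 3 - 2 / 3 * s <= #|supp g|%:R.
  by move=> Gg g1; have := min_degree_ttrans trG nAG sn s48 Gg g1; lra.
have := avg_stab_le_fixity nT0 actS S0 x0 lam0 fixS hmu.
rewrite -/lam -/l => avgle.
have sqrtn : Num.sqrt #|T|%:R = s :> R by rewrite -sn sqrtr_sqr ger0_norm // ltW // expR_gt0.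
have xiE (r : R) : xi `^ r = expR (- (lam * r)).
  by rewrite /powR gt_eqF // /lam mulNr opprK mulrC.
(* The margin delta s in the exponent absorbs ln |G| and the polynomial factor. *)
have bound : avg_stab to R G S - 1 <= xi `^ (#|T|%:R / 3 - (2 / 3 + delta) * s).
  apply: le_trans avgle _; rewrite -[#|G|%:R]lnK ?posrE // -/L -expRD xiE ler_expR.
  by move: E; lra.
split; last by rewrite sqrtn.
apply: le_trans (regular_ratio_ge R actS S0).
rewrite lerD2l lerN2; apply: (@le_trans _ _ (2 * expR (- (eps / 2 * s)))).
  rewrite ler_pM2l //; apply: le_trans bound _; rewrite xiE ler_expR lerN2.
  apply: (@le_trans _ _ (lam * s)); first by rewrite ler_pM2r //; lra.
  rewrite ler_pM2l //.
  have h1 : delta * s <= 1 / 8 * s by rewrite ler_pM2r //; lra.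
  have h2 : 48 * s <= s ^+ 2 by rewrite expr2 ler_pM2r //; lra.
  by rewrite -sn; lra.
by apply: le_trans (Hs0 s s00) _; rewrite sn /harmonic natr1.
Qed.

End Conclusion.

Lemma acts_msubsets (T : finType) (G : {group {perm T}}) m : [acts G, on msubsets T m | 'P^*].
Proof.
apply/actsP => g _ A; rewrite !inE /= /setact card_imset //; exact: act_inj.
Qed.

Lemma acts_multisets (T : finType) (G : {group {perm T}}) m :
  [acts G, on multisets T m | multiset_action T m].
Proof.
apply/actsP => g _ k; rewrite !inE /= (reindex_inj (@perm_inj _ g)) /=.
by congr (_ == _); apply: eq_bigr => x _; rewrite ffunE permK.
Qed.

(** * The two actions *)

Section Instances.
Variables (R : realType) (T : finType) (m : nat).
Let n : R := #|T|%:R.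

(** With p = m / n in (eps, 1 - eps), xi^2 = 1 - 2 p (1 - p). *)
Lemma subsets_setting (eps : R) : 0 < eps < 1 / 2 -> (0 < #|T|)%N ->
  n * eps < m%:R < n * (1 - eps) ->
  let xi := xi_subsets R #|T| m in
  [/\ (0 < #|msubsets T m|)%N, 0 < xi, eps / 2 <= xi ^+ 2, xi ^+ 2 <= 1 - eps &
    geometric_fixity eps ('P^*)%act (msubsets T m) xi].
Proof.
move=> /andP [e0 e1] n0 /andP [lo hi] xi.
have nR : 0 < n by rewrite /n ltr0n.
have ne : 0 < n * eps by rewrite mulr_gt0.
have m0 : (0 < m)%N by rewrite -(ltr_nat R); lra.
have mnR : m%:R < n by lra.
have mn : (m < #|T|)%N by rewrite -(ltr_nat R).
have n2 : 0 < n ^+ 2 by rewrite exprn_gt0.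
pose p := m%:R / n; have pn : m%:R = p * n by rewrite /p divfK // gt_eqF.
have p0 : eps < p by rewrite /p ltr_pdivlMr // mulrC.
have p1 : p < 1 - eps by rewrite /p ltr_pdivrMr // mulrC.
have xi2 : xi ^+ 2 = (m%:R ^+ 2 + (n - m%:R) ^+ 2) / n ^+ 2.
  by rewrite /xi /xi_subsets expr_div_n sqr_sqrtr // addr_ge0 ?sqr_ge0.
have xi2p : xi ^+ 2 = p ^+ 2 + (1 - p) ^+ 2 by rewrite xi2 pn; field; rewrite gt_eqF.
have xi0 : 0 < xi.
  rewrite divr_gt0 // sqrtr_gt0; have := sqr_ge0 (n - m%:R).
  by have : 0 < m%:R ^+ 2 :> R by [rewrite exprn_gt0 // ltr0n]; lra.
split=> //.
- by rewrite card_draws bin_gt0 ltnW.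
- by rewrite xi2p; nra.
- by rewrite xi2p; nra.
move=> g; apply: le_trans (fix_ratio_subsets g (introT andP (conj m0 mn)) (ltW xi0) xi2) _.
apply: ler_wpM2r => //; apply: ler_wpM2r; first by rewrite exprn_ge0 // ltW.
have e2 : 2 <= eps^-1 by rewrite -[2]invrK lef_pV2 ?posrE //; lra.
have n1 : 1 <= n by rewrite /n ler1n.
rewrite -/n; have : 2 <= (1 + eps^-1) ^+ 2 by nra.
by move/(ler_wpM2r (ltW nR)); lra.
Qed.

(** At the ends of the range of m, n / (n + 2 m) equals (1 - eps) / (1 + eps) and eps / (2 - eps);
    the latter is the source of the lower bound eps / 2. *)
Lemma multisets_setting (eps : R) : 0 < eps < 1 / 2 -> (0 < #|T|)%N ->
  n * eps / (1 - eps) < m%:R < n * (1 - eps) / eps ->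
  let xi := xi_multisets R #|T| m in
  [/\ (0 < #|multisets T m|)%N, 0 < xi, eps / 2 <= xi ^+ 2, xi ^+ 2 <= 1 - eps &
    geometric_fixity eps (multiset_action T m) (multisets T m) xi].
Proof.
move=> /andP [e0 e1] n0 /andP [lo hi] xi.
have nR : 0 < n by rewrite /n ltr0n.
have e1' : 0 < 1 - eps by lra.
have ne : 0 < n * eps / (1 - eps) by rewrite divr_gt0 // mulr_gt0.
have m0 : (0 < m)%N by rewrite -(ltr_nat R); lra.
have mR : 0 < m%:R :> R by rewrite ltr0n.
have lo' : n * eps < m%:R * (1 - eps) by rewrite -ltr_pdivrMr.
have hi' : m%:R * eps < n * (1 - eps) by rewrite -ltr_pdivlMr.
have nm : 0 < n + 2 * m%:R by rewrite addr_gt0 // mulr_gt0.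
have xi2 : xi ^+ 2 = n / (n + 2 * m%:R).
  by rewrite /xi /xi_multisets sqr_sqrtr // divr_ge0 // ltW.
have xi0 : 0 < xi by rewrite sqrtr_gt0 divr_gt0.
split=> //.
- by apply: leq_trans (card_multisets m n0); rewrite bin_gt0; have := n0; clear; lia.
- by rewrite xi2 ler_pdivlMr //; nra.
- by rewrite xi2 ler_pdivrMr //; nra.
move=> g; apply: le_trans (fix_ratio_multisets g m0 n0 (ltW xi0) xi2) _.
apply: ler_wpM2r => //; apply: ler_wpM2r; first by rewrite exprn_ge0 // ltW.
rewrite -/n ler_pdivrMr // -mulrA -expr2 -exprMn lerXn2r ?nnegrE //.
- by rewrite addr_ge0 // ltW.
- by rewrite mulr_ge0 ?(ltW nR) // addr_ge0 // invr_ge0 ltW.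
rewrite mulrDl mul1r lerD2l mulrC ler_pdivlMr //.
have : 0 < n * eps by rewrite mulr_gt0.
by lra.
Qed.

End Instances.

Theorem mainTheorem6 (R : realType) (eps : R) (heps : 0 < eps < 1 / 2) :
  exists2 u : nat -> R, u @ \oo --> (0 : R) &
  forall delta : R, 0 < delta < 1 / 8 ->
  exists n0 : nat,
  forall (T : finType) (G : {group {perm T}}),
  (n0 < #|T|)%N -> [transitive G, on [set: T]%SET | 'P] ->
  let n := #|T| in
  (forall m : nat, n%:R * eps < m%:R < n%:R * (1 - eps) ->
     let to := ('P^*)%act in
     let S := msubsets T m in
     let xi := xi_subsets R n m in
     (uniprimitive G -> has_large_orbit to G S delta xi) /\
     (two_transitive G ->
      G :!=: ('Sym_T)%g -> G :!=: ('Alt_T)%g ->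
      mostly_regular to G S n u delta xi)) /\
  (forall m : nat,
     n%:R * eps / (1 - eps) < m%:R < n%:R * (1 - eps) / eps ->
     let to := multiset_action T m in
     let S := multisets T m in
     let xi := xi_multisets R n m in
     (uniprimitive G -> has_large_orbit to G S delta xi) /\
     (two_transitive G ->
      G :!=: ('Sym_T)%g -> G :!=: ('Alt_T)%g ->
      mostly_regular to G S n u delta xi)).
Proof.
exists (@harmonic R) => [|delta hdelta]; first exact: cvg_harmonic.
have [n1 H1] := uniprimitive_large_orbit heps hdelta.
have [n2 H2] := two_transitive_mostly_regular heps hdelta.
exists (maxn n1 n2) => T G; rewrite gtn_max => /andP [n1T n2T] _.
have n0 : (0 < #|T|)%N by apply: leq_ltn_trans n1T.
split=> m hm to S xi.
  have [S0 xi0 xilo xihi fixS] := subsets_setting heps n0 hm.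
  have actS := acts_msubsets G m.
  split=> [uG|tG nS nA]; first exact: H1.
  exact: H2.
have [S0 xi0 xilo xihi fixS] := multisets_setting heps n0 hm.
have actS := acts_multisets G m.
split=> [uG|tG nS nA]; first exact: H1.
exact: H2.
Qed.
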